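(* Let $\mathcal{C}$ be a family of separable, weakly semiprojective $C^*$-algebras. Then every separable $A\mathcal{C}$-like $C^*$-algebra is already an $A\mathcal{C}$-algebra.
   Context: A morphism between $C^*$-algebras is a $*$-homomorphism (not assumed unital); ideals are closed and two-sided. A $C^*$-algebra $A$ is weakly semiprojective if for every $C^*$-algebra $C$, increasing sequence of ideals $J_1\subseteq J_2\subseteq\cdots$ of $C$, morphism $\sigma\colon A\to C/\overline{\bigcup_k J_k}$, $\varepsilon>0$ and finite $F\subseteq A$, there exist an index $k$ and a morphism $\psi\colon A\to C/J_k$ with $\|\pi_k(\psi(x))-\sigma(x)\|<\varepsilon$ for all $x\in F$, where $\pi_k\colon C/J_k\to C/\overline{\bigcup_k J_k}$ is the quotient morphism. An $A\mathcal{C}$-algebra is a $C^*$-algebra isomorphic to the inductive limit of a sequential inductive system $C_1\to C_2\to\cdots$ of algebras in $\mathcal{C}$ (connecting morphisms not necessarily injective). A $C^*$-algebra $A$ is $A\mathcal{C}$-like if it can be approximated by sub-$C^*$-algebras that are $A\mathcal{C}$-algebras: for every $\varepsilon>0$ and finite $F\subseteq A$ there is a sub-$C^*$-algebra $B\subseteq A$ that is an $A\mathcal{C}$-algebra and such that for each $x\in F$ there is $y\in B$ with $\|x-y\|<\varepsilon$. *)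

(* Defs.v *)
From HB Require Import structures.
From mathcomp Require Import all_boot all_order all_algebra.
From mathcomp Require Import generic_quotient ring_quotient.
From mathcomp Require Import complex.
From mathcomp Require Import all_classical all_reals topology normedtype.

Set Implicit Arguments.
Unset Strict Implicit.
Unset Printing Implicit Defensive.

Import Order.TTheory GRing.Theory Num.Theory.
Import numFieldNormedType.Exports.

Local Open Scope classical_set_scope.
Local Open Scope quotient_scope.
Local Open Scope complex_scope.
Local Open Scope ring_scope.

(* C*-algebras are not assumed unital, so they cannot be built on pzRingType. *)

HB.mixin Record hasMulStar (A : Type) := {
  amul : A -> A -> A;
  astar : A -> A
}.

(* The product and the involution of a starLmodType are unconstrained: this
   structure only carries the operations that a *-homomorphism preserves. *)
#[short(type="starLmodType")]
HB.structure Definition StarLmodule (R : realType) :=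
  {A of GRing.Lmodule R[i] A & hasMulStar A}.

HB.mixin Record isCstarAlgebra (R : realType) A
    of CompleteNormedModule R[i] A & hasMulStar A := {
  amulA : forall x y z : A, amul x (amul y z) = amul (amul x y) z;
  amulDl : forall x y z : A, amul (x + y) z = amul x z + amul y z;
  amulDr : forall x y z : A, amul x (y + z) = amul x y + amul x z;
  amulZl : forall (a : R[i]) (x y : A), amul (a *: x) y = a *: amul x y;
  amulZr : forall (a : R[i]) (x y : A), amul x (a *: y) = a *: amul x y;
  astarK : forall x : A, astar (astar x) = x;
  astarD : forall x y : A, astar (x + y) = astar x + astar y;
  astarZ : forall (a : R[i]) (x : A), astar (a *: x) = conjc a *: astar x;
  astarM : forall x y : A, astar (amul x y) = amul (astar y) (astar x);
  normaM : forall x y : A, `|amul x y| <= `|x| * `|y|;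
  normCstar : forall x : A, `|amul (astar x) x| = `|x| ^+ 2
}.

#[short(type="cstarType")]
HB.structure Definition CstarAlgebra (R : realType) :=
  {A of CompleteNormedModule R[i] A & hasMulStar A & isCstarAlgebra R A}.

Record star_hom (R : realType) (A B : starLmodType R) (f : A -> B) : Prop :=
  StarHom {
    star_hom_linear : linear f;
    star_homM : forall x y, f (amul x y) = amul (f x) (f y);
    star_homV : forall x, f (astar x) = astar (f x)
  }.

Definition isomorphic (R : realType) (A B : starLmodType R) : Prop :=
  exists2 f : A -> B, star_hom f & bijective f.

Definition separable (T : topologicalType) : Prop :=
  exists2 D : set T, countable D & dense D.

Lemma amul_continuous (R : realType) (A : cstarType R) (a : A) :
  continuous (amul a) /\ continuous (amul ^~ a).
Proof.
have lip (f : A -> A) : (forall x y, f (x - y) = f x - f y) ->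
    (forall x, `|f x| <= `|a| * `|x|) -> continuous f.
  move=> fB fle x; apply/cvgrPdist_lt => e e0.
  have d0 : 0 < e / (`|a| + 1).
    by rewrite divr_gt0// (lt_le_trans ltr01)// lerDr normr_ge0.
  apply/nbhs_normP; exists (e / (`|a| + 1)) => // y /= xy.
  rewrite -fB (le_lt_trans (fle _))//.
  rewrite (@le_lt_trans _ _ ((`|a| + 1) * `|x - y|))//.
    by rewrite ler_wpM2r ?normr_ge0// lerDl.
  by rewrite mulrC -ltr_pdivlMr ?(lt_le_trans ltr01) ?lerDr ?normr_ge0.
split; apply: lip => [x y|x].
- by rewrite -(scaleN1r y) amulDr amulZr scaleN1r.
- exact: normaM.
- by rewrite -(scaleN1r y) amulDl amulZl scaleN1r.
- by rewrite mulrC; exact: normaM.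
Qed.

Section Ideal.
Variables (R : realType) (A : cstarType R).

Record ideal := Ideal {
  ideal_set :> set A;
  ideal_closed : closed ideal_set;
  ideal_set0 : ideal_set 0;
  ideal_setD : forall x y, ideal_set x -> ideal_set y -> ideal_set (x + y);
  ideal_setZ : forall (a : R[i]) x, ideal_set x -> ideal_set (a *: x);
  ideal_setMl : forall a x, ideal_set x -> ideal_set (amul a x);
  ideal_setMr : forall a x, ideal_set x -> ideal_set (amul x a)
}.

Definition in_ideal (J : ideal) : {pred A} := fun x => `[< ideal_set J x >].

Lemma in_ideal_zmod_closed (J : ideal) : zmod_closed (in_ideal J).
Proof.
split; first by apply/asboolP; exact: ideal_set0.
move=> x y /asboolP Jx /asboolP Jy; apply/asboolP.
by apply: ideal_setD => //; rewrite -scaleN1r; exact: ideal_setZ.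
Qed.

HB.instance Definition _ (J : ideal) :=
  GRing.isZmodClosed.Build A (in_ideal J) (in_ideal_zmod_closed J).

Section ClosureOfUnion.
Variables (J : nat -> ideal) (incJ : forall k, J k `<=` J k.+1).

Let U : set A := closure (\bigcup_k (J k : set A)).

Let leJ m n : (m <= n)%N -> J m `<=` J n.
Proof.
move=> /subnK <-; elim: (n - m)%N => [|k IHk]//.
by rewrite addSn; apply: subset_trans IHk _; exact: incJ.
Qed.

Let U_cont (f : A -> A) : continuous f ->
  (forall k x, ideal_set (J k) x -> ideal_set (J k) (f x)) -> forall x, U x -> U (f x).
Proof.
move=> cf fJ x Ux V /cf/Ux[y [[k _ Jy] Vy]].
by exists (f y); split=> //; exists k => //; exact: fJ.
Qed.

Let U0 : U 0.
Proof. by apply: subset_closure; exists 0%N => //; exact: ideal_set0. Qed.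

Let UD x y : U x -> U y -> U (x + y).
Proof.
move=> Ux Uy V /(@add_continuous _ (x, y))[[/= V1 V2] [xV yV] VV].
have [a [[k _ Ja] V1a]] := Ux _ xV.
have [b [[l _ Jb] V2b]] := Uy _ yV.
exists (a + b); split; last exact: (VV (a, b)).
exists (maxn k l) => //; apply: ideal_setD.
- exact: (leJ (leq_maxl k l)).
- exact: (leJ (leq_maxr k l)).
Qed.

Let UZ (a : R[i]) x : U x -> U (a *: x).
Proof.
by apply: U_cont => [|k y]; [exact: scaler_continuous | exact: ideal_setZ].
Qed.

Let UMl a x : U x -> U (amul a x).
Proof.
by apply: U_cont => [|k y]; [exact: (amul_continuous a).1 | exact: ideal_setMl].
Qed.

Let UMr a x : U x -> U (amul x a).
Proof.
by apply: (@U_cont (amul ^~ a)) => [|k y];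
  [exact: (amul_continuous a).2 | exact: ideal_setMr].
Qed.

Definition ideal_closure_union : ideal :=
  Ideal (@closed_closure _ _) U0 UD UZ UMl UMr.

End ClosureOfUnion.

End Ideal.

Section Quotient.
Variables (R : realType) (A : cstarType R) (J : ideal A).

Definition cquot := {ideal_quot in_ideal J}.

HB.instance Definition _ := GRing.Zmodule.on cquot.
HB.instance Definition _ := EqQuotient.on cquot.

(* The operations on A / J are computed on chosen representatives.  The choice
   is immaterial: J is a closed two-sided ideal, hence also self-adjoint. *)
Definition cquot_scale (a : R[i]) : cquot -> cquot :=
  fun x => \pi_cquot (a *: repr x).
Definition cquot_mul : cquot -> cquot -> cquot :=
  fun x y => \pi_cquot (amul (repr x) (repr y)).
Definition cquot_star : cquot -> cquot :=
  fun x => \pi_cquot (astar (repr x)).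

Lemma cquot_piP (x y : A) : \pi_cquot x = \pi_cquot y <-> ideal_set J (x - y).
Proof.
have E : (x - y \in in_ideal J) = (\pi_cquot x == \pi_cquot y).
  exact: Quotient.idealrBE.
by split=> [/eqP|Jxy]; [rewrite -E => /asboolP | apply/eqP; rewrite -E;
  apply/asboolP].
Qed.

Lemma cquot_repr (x : A) : ideal_set J (repr (\pi_cquot x) - x).
Proof. by apply/cquot_piP; rewrite reprK. Qed.

Lemma cquot_piD (x y : A) : \pi_cquot (x + y) = \pi_cquot x + \pi_cquot y.
Proof. by rewrite !piE. Qed.

Lemma cquot_piZ (a : R[i]) (x : A) :
  \pi_cquot (a *: x) = cquot_scale a (\pi_cquot x).
Proof.
apply/cquot_piP; rewrite -scalerBr; apply: ideal_setZ.
by rewrite -opprB -scaleN1r; apply: ideal_setZ; exact: cquot_repr.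
Qed.

Let cquotP (q : cquot) : exists x, q = \pi_cquot x.
Proof. by exists (repr q); rewrite reprK. Qed.

Lemma cquot_scaleA (a b : R[i]) x :
  cquot_scale a (cquot_scale b x) = cquot_scale (a * b) x.
Proof. by have [y ->] := cquotP x; rewrite -!cquot_piZ scalerA. Qed.

Lemma cquot_scale1 : left_id 1 cquot_scale.
Proof. by move=> x; have [y ->] := cquotP x; rewrite -cquot_piZ scale1r. Qed.

Lemma cquot_scaleDr : right_distributive cquot_scale +%R.
Proof.
move=> a x y; have [[u ->] [v ->]] := (cquotP x, cquotP y).
by rewrite -cquot_piD -!cquot_piZ scalerDr cquot_piD.
Qed.

Lemma cquot_scaleDl x : {morph cquot_scale^~ x : a b / a + b}.
Proof.
move=> a b /=; have [y ->] := cquotP x.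
by rewrite -!cquot_piZ scalerDl cquot_piD.
Qed.

HB.instance Definition _ := GRing.Zmodule_isLmodule.Build R[i] cquot
  cquot_scaleA cquot_scale1 cquot_scaleDr cquot_scaleDl.
HB.instance Definition _ := hasMulStar.Build cquot cquot_mul cquot_star.

Definition cquot_norm (q : cquot) : R :=
  inf [set complex.Re `|x| | x in [set x : A | \pi_cquot x = q]].

End Quotient.

(* The canonical map A / J -> A / K, meaningful when J is contained in K. *)
Definition cquot_map (R : realType) (A : cstarType R) (J K : ideal A)
  (q : cquot J) : cquot K := \pi_(cquot K) (repr q).

Definition weakly_semiprojective (R : realType) (A : cstarType R) : Prop :=
  forall (C : cstarType R) (J : nat -> ideal C)
    (incJ : forall k, J k `<=` J k.+1)
    (sigma : A -> cquot (ideal_closure_union incJ)) (eps : R) (F : set A),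
  star_hom sigma -> 0 < eps -> finite_set F ->
  exists (k : nat) (psi : A -> cquot (J k)),
    star_hom psi /\
    forall x, F x ->
      cquot_norm (cquot_map (ideal_closure_union incJ) (psi x) - sigma x) < eps.

Section SubCstar.
Variables (R : realType) (A : cstarType R).

Record subCstar := SubCstar {
  sub_set :> set A;
  sub_closed : closed sub_set;
  sub_set0 : sub_set 0;
  sub_setD : forall x y, sub_set x -> sub_set y -> sub_set (x + y);
  sub_setZ : forall (a : R[i]) x, sub_set x -> sub_set (a *: x);
  sub_setM : forall x y, sub_set x -> sub_set y -> sub_set (amul x y);
  sub_setV : forall x, sub_set x -> sub_set (astar x)
}.

Definition in_sub (B : subCstar) : {pred A} := fun x => `[< sub_set B x >].

Lemma in_sub_submod_closed (B : subCstar) : submod_closed (in_sub B).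
Proof.
split; first by apply/asboolP; exact: sub_set0.
move=> a x y /asboolP Bx /asboolP By; apply/asboolP.
by apply: sub_setD => //; exact: sub_setZ.
Qed.

HB.instance Definition _ (B : subCstar) :=
  GRing.isSubmodClosed.Build R[i] A (in_sub B) (in_sub_submod_closed B).

Variable B : subCstar.

Definition sub_alg := {x : A | x \in in_sub B}.

HB.instance Definition _ := [isSub of sub_alg for @sval _ _].
HB.instance Definition _ := [Choice of sub_alg by <:].
HB.instance Definition _ := [SubChoice_isSubLmodule of sub_alg by <:].

Let nrm (x : sub_alg) : R[i] := `|val x|.

Let nrmD x y : nrm (x + y) <= nrm x + nrm y.
Proof. exact: ler_normD. Qed.

Let nrmZ (l : R[i]) x : nrm (l *: x) = `|l| * nrm x.
Proof. exact: normrZ. Qed.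

Let nrm_eq0 x : nrm x = 0 -> x = 0.
Proof. by move=> /normr0_eq0 x0; apply: val_inj. Qed.

HB.instance Definition _ :=
  Lmodule_isNormed.Build R[i] sub_alg nrmD nrmZ nrm_eq0.

Let norm_val (x : sub_alg) : `|x| = `|val x|. Proof. by []. Qed.

Lemma sub_alg_complete (F : set_system sub_alg) :
  ProperFilter F -> cauchy F -> cvg F.
Proof.
move=> FF /cauchy_ballP Fc.
have /cauchy_cvgP/cvg_ex[l Fl] : cauchy (val @ F).
  apply/cauchy_ballP => e e0; rewrite near_map2.
  have := Fc _ e0; apply: filterS => -[x y] /=.
  by rewrite -!ball_normE /= norm_val raddfB.
have Bl : l \in in_sub B.
  apply/asboolP; apply: sub_closed => V Vl.
  have [x Vx] := @filter_ex _ F _ _ (Fl _ Vl).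
  by exists (val x); split=> //; exact/asboolP/(valP x).
apply/cvg_ex; exists (exist _ l Bl); apply/cvgrPdist_lt => e e0.
move/cvgrPdist_lt : Fl => /(_ e e0).
by apply: filterS => x; rewrite norm_val raddfB.
Qed.

HB.instance Definition _ := Uniform_isComplete.Build sub_alg sub_alg_complete.

Let sub_mulP (x y : sub_alg) : amul (val x) (val y) \in in_sub B.
Proof. by apply/asboolP/sub_setM; [move/asboolP: (valP x)|move/asboolP: (valP y)]. Qed.

Let sub_starP (x : sub_alg) : astar (val x) \in in_sub B.
Proof. by apply/asboolP/sub_setV; move/asboolP: (valP x). Qed.

Definition sub_mul (x y : sub_alg) : sub_alg := Sub (amul (val x) (val y)) (sub_mulP x y).
Definition sub_star (x : sub_alg) : sub_alg := Sub (astar (val x)) (sub_starP x).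

HB.instance Definition _ := hasMulStar.Build sub_alg sub_mul sub_star.

Let smulA (x y z : sub_alg) : amul x (amul y z) = amul (amul x y) z.
Proof. by apply: val_inj; exact: amulA. Qed.
Let smulDl (x y z : sub_alg) : amul (x + y) z = amul x z + amul y z.
Proof. by apply: val_inj; exact: amulDl. Qed.
Let smulDr (x y z : sub_alg) : amul x (y + z) = amul x y + amul x z.
Proof. by apply: val_inj; exact: amulDr. Qed.
Let smulZl (a : R[i]) (x y : sub_alg) : amul (a *: x) y = a *: amul x y.
Proof. by apply: val_inj; exact: amulZl. Qed.
Let smulZr (a : R[i]) (x y : sub_alg) : amul x (a *: y) = a *: amul x y.
Proof. by apply: val_inj; exact: amulZr. Qed.
Let sstarK (x : sub_alg) : astar (astar x) = x.
Proof. by apply: val_inj; exact: astarK. Qed.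
Let sstarD (x y : sub_alg) : astar (x + y) = astar x + astar y.
Proof. by apply: val_inj; exact: astarD. Qed.
Let sstarZ (a : R[i]) (x : sub_alg) : astar (a *: x) = conjc a *: astar x.
Proof. by apply: val_inj; exact: astarZ. Qed.
Let sstarM (x y : sub_alg) : astar (amul x y) = amul (astar y) (astar x).
Proof. by apply: val_inj; exact: astarM. Qed.
Let snormM (x y : sub_alg) : `|amul x y| <= `|x| * `|y|.
Proof. exact: normaM. Qed.
Let snormC (x : sub_alg) : `|amul (astar x) x| = `|x| ^+ 2.
Proof. exact: normCstar. Qed.

HB.instance Definition _ := isCstarAlgebra.Build R sub_alg
  smulA smulDl smulDr smulZl smulZr sstarK sstarD sstarZ sstarM snormM snormC.

End SubCstar.

Section InductiveLimit.
Variables (R : realType) (C : nat -> cstarType R).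
Variable phi : forall n, C n -> C n.+1.

Definition cocone (B : cstarType R) (nu : forall n, C n -> B) : Prop :=
  (forall n, star_hom (nu n)) /\ (forall n x, nu n.+1 (phi x) = nu n x).

Definition inductive_limit (L : cstarType R) (mu : forall n, C n -> L) : Prop :=
  cocone mu /\
  forall (B : cstarType R) (nu : forall n, C n -> B), cocone nu ->
    exists! g : L -> B, star_hom g /\ forall n x, g (mu n x) = nu n x.

End InductiveLimit.

Section AC.
Variables (R : realType) (CC : cstarType R -> Prop).

Definition AC_algebra (A : cstarType R) : Prop :=
  exists (C : nat -> cstarType R) (phi : forall n, C n -> C n.+1)
    (L : cstarType R) (mu : forall n, C n -> L),
    [/\ forall n, CC (C n), forall n, star_hom (phi n),
        inductive_limit phi mu & isomorphic L A].

Definition AC_like (A : cstarType R) : Prop :=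
  forall (eps : R) (F : set A), 0 < eps -> finite_set F ->
  exists B : subCstar A, AC_algebra (sub_alg B) /\
    forall x, F x -> exists2 y, sub_set B y & `|x - y| < eps%:C.

End AC.

(* Main.v *)
From HB Require Import structures.
Require Import Defs.
From mathcomp Require Import all_boot all_order all_algebra.
From mathcomp Require Import generic_quotient complex lra.
From mathcomp Require Import all_classical all_reals topology normedtype.

(* Choose AC-subalgebras B_n of A such that every point of A is a limit of points
   b_n in B_n.  A morphism from a weakly semiprojective P into A lifts
   approximately to some B_n: it is a morphism into the algebra of convergent
   sequences (b_n) with b_n in B_n, modulo the null sequences.  Likewise a
   morphism from P into an inductive limit lifts approximately to the stages,
   the limit being mapped into the asymptotically coherent sequences modulo the
   null sequences.  Alternating the two lifts gives algebras C_n in CC, morphisms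
   chi_n : C_n -> A and phi_n : C_n -> C_(n+1) such that, on larger and larger
   finite sets, chi_(n+1) o phi_n is close to chi_n and |phi_n x| is at most
   slightly larger than |chi_n x|.  The limits mu_n = lim_m chi_m o phi_(n,m)
   form a cocone; the estimate on |phi_n x| makes the induced map on the
   inductive limit isometric, hence A is the inductive limit of the C_n. *)

Set Implicit Arguments.
Unset Strict Implicit.
Unset Printing Implicit Defensive.

Import Order.TTheory GRing.Theory Num.Theory.
Import numFieldNormedType.Exports.

Local Open Scope classical_set_scope.
Local Open Scope quotient_scope.
Local Open Scope complex_scope.
Local Open Scope ring_scope.

(** Two features of the definitions shape the proof. Weak semiprojectivity only lifts morphisms from
    the quotient by the closure of an increasing union of ideals. Both lifting problems are
    therefore cast in that form: inside an algebra of sequences, those vanishing from index k on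
    form an ideal, these ideals have the null sequences as the closure of their union, and modulo
    the k-th one every coordinate n >= k can still be evaluated. Inductive limits, in turn, are
    known only by their universal property, which gives no formula for the norm; the norm estimate
    comes from the morphism that this property provides from the limit to coherent sequences modulo
    null sequences, because morphisms are contractive. The control of |phi_n x| is there because the
    maps chi_n may have kernels: closeness of images in A alone would allow the induced map from the
    limit of the C_n to A to have one too. Since a lift is good only on a finite set, each C_n
    carries a dense sequence that contains the image of the preceding one, and the number of tracked
    terms grows fast enough to reach every term. *)

(* Norms of an [R[i]]-normed module take values in [R[i]]; [rnorm] is the same
   norm with values in [R], where [lra] applies. *)
Definition rnorm (R : realType) (V : normedModType R[i]) (x : V) : R :=
  complex.Re `|x|.

(** * Real-valued norms, closures and limits of sequences *)

Section RealNorm.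
Variables (R : realType) (V : normedModType R[i]).
Implicit Types (x y z : V) (e : R).

Lemma rnormE x : (rnorm x)%:C = `|x|.
Proof. by rewrite /rnorm RRe_real// ger0_real. Qed.

Lemma rnorm_ge0 x : 0 <= rnorm x.
Proof. by rewrite -lecR rnormE normr_ge0. Qed.

Lemma rnorm0 : rnorm (0 : V) = 0.
Proof. by rewrite /rnorm normr0. Qed.

Lemma rnorm_eq0 x : rnorm x = 0 -> x = 0.
Proof. by move=> x0; apply: normr0_eq0; rewrite -rnormE x0. Qed.

Lemma rnormN x : rnorm (- x) = rnorm x.
Proof. by rewrite /rnorm normrN. Qed.

Lemma rnormBC x y : rnorm (x - y) = rnorm (y - x).
Proof. by rewrite /rnorm distrC. Qed.

Lemma rnormD x y : rnorm (x + y) <= rnorm x + rnorm y.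
Proof. by rewrite -lecR rmorphD/= !rnormE ler_normD. Qed.

Lemma rnormB x y : rnorm (x - y) <= rnorm x + rnorm y.
Proof. by rewrite -(rnormN y) rnormD. Qed.

Lemma rnorm_dist z x y : rnorm (x - y) <= rnorm (x - z) + rnorm (z - y).
Proof. by rewrite -[x - y](subrKA z) rnormD. Qed.

Lemma rnorm_le_dist x y : rnorm x <= rnorm y + rnorm (x - y).
Proof. by rewrite -{1}(subrK y x) addrC rnormD. Qed.

Lemma rnormZ (a : R[i]) x : rnorm (a *: x) = complex.Re `|a| * rnorm x.
Proof.
apply: complexI; rewrite rnormE normrZ -rnormE rmorphM/=.
by rewrite RRe_real// ger0_real.
Qed.

Lemma rnormZr (a : R) x : rnorm (a%:C *: x) = `|a| * rnorm x.
Proof. by rewrite rnormZ normc_def/= expr0n/= addr0 sqrtr_sqr. Qed.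

Lemma normc_lt x e : (`|x| < e%:C) = (rnorm x < e).
Proof. by rewrite -rnormE ltcR. Qed.

Lemma posc_real (e : R[i]) : 0 < e -> exists2 r : R, 0 < r & e = r%:C.
Proof.
case: e => r s; rewrite ltcE/= => /andP[/eqP-> r0]; exists r => //.
Qed.

Lemma closure_rnormP (S : set V) x :
  closure S x <-> forall e, 0 < e -> exists2 y, S y & rnorm (x - y) < e.
Proof.
split=> [Sx e e0|H W /nbhs_normP[/= _ /posc_real[e e0 ->] eW]].
  have [|y [Sy]] := Sx (ball x e%:C); first by apply: nbhsx_ballx; rewrite ltcR.
  by rewrite -ball_normE/= normc_lt; exists y.
have [y Sy xy] := H e e0; exists y; split=> //.
by apply: eW; rewrite /= normc_lt.
Qed.

Lemma closed_rnormP (S : set V) :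
  (forall x, (forall e, 0 < e -> exists2 y, S y & rnorm (x - y) < e) -> S x) ->
  closed S.
Proof. by move=> SS x /closure_rnormP/SS. Qed.

Lemma cvg_rnormP (u : nat -> V) x : u @ \oo --> x <->
  forall e, 0 < e -> exists N, forall n, (N <= n)%N -> rnorm (x - u n) < e.
Proof.
split=> [/cvgrPdist_lt ux e e0|H].
  have [|N _ NP] := ux e%:C; first by rewrite ltcR.
  by exists N => n /NP; rewrite /= normc_lt.
apply/cvgrPdist_lt => _ /posc_real[e e0 ->].
by have [N NP] := H e e0; exists N => // n /NP/=; rewrite normc_lt.
Qed.

Lemma seq_cvg_unique (u : nat -> V) x y : u @ \oo --> x -> u @ \oo --> y -> x = y.
Proof. by move=> ux uy; apply: norm_cvg_unique ux uy. Qed.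

Lemma cvg_eventually (u v : nat -> V) x N :
  (forall n, (N <= n)%N -> u n = v n) -> u @ \oo --> x -> v @ \oo --> x.
Proof.
move=> uv /cvg_rnormP ux; apply/cvg_rnormP => e /ux[M MP].
by exists (maxn M N) => n; rewrite geq_max => /andP[/MP ? /uv <-].
Qed.

Lemma cvg_scale (a : R[i]) (u : nat -> V) x :
  u @ \oo --> x -> (fun n => a *: u n) @ \oo --> a *: x.
Proof. by apply: cvgZ; exact: cvg_cst. Qed.

Lemma cvg_subseq (u : nat -> V) (s : nat -> nat) x :
  (forall n, (n <= s n)%N) -> u @ \oo --> x -> (u \o s) @ \oo --> x.
Proof.
move=> sn /cvg_rnormP ux; apply/cvg_rnormP => e /ux[N NP].
by exists N => n Nn; apply: NP; exact: leq_trans Nn (sn n).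
Qed.

End RealNorm.

Lemma leq_ind k (P : nat -> Prop) :
  P k -> (forall n, (k <= n)%N -> P n -> P n.+1) -> forall n, (k <= n)%N -> P n.
Proof.
move=> Pk PS n /subnK <-; elim: (n - k)%N => // m.
by apply: PS; exact: leq_addl.
Qed.

(** * Completeness tested on sequences with geometric steps *)

Section Geometric.
Variable R : realType.

Definition geo (n : nat) : R := 2%:R ^- n.

Lemma geo_gt0 n : 0 < geo n.
Proof. by rewrite invr_gt0 exprn_gt0. Qed.

Lemma geoS n : geo n = geo n.+1 + geo n.+1.
Proof. by rewrite /geo exprS invfM; lra. Qed.

Lemma geo_le m n : (m <= n)%N -> geo n <= geo m.
Proof.
move/subnK <-; elim: (n - m)%N => // k; apply: le_trans.
by rewrite addSn [leRHS]geoS lerDl ltW// geo_gt0.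
Qed.

Lemma geo_lt e : 0 < e -> exists N, forall n, (N <= n)%N -> geo n < e.
Proof.
move=> e0.
have e'0 : 0 < e^-1 by rewrite invr_gt0.
exists (Num.truncn e^-1).+1 => n; set N := _.+1 => Nn; apply: le_lt_trans (geo_le Nn) _.
rewrite /geo invf_plt ?posrE ?exprn_gt0//; apply: lt_le_trans (truncnS_gt _) _.
by rewrite -/N -natrX ler_nat ltnW// ltn_expl.
Qed.

Variable V : normedModType R[i].

Definition fast (u : nat -> V) := forall n, rnorm (u n.+1 - u n) <= geo n.

(** The subtracted [geo n + geo n] is the tail of the geometric series still to come; with it the
    induction step is an exact balance. *)
Lemma geo_dist (u : nat -> V) m :
  (forall n, (m <= n)%N -> rnorm (u n.+1 - u n) <= geo n) ->
  forall n, (m <= n)%N -> rnorm (u n - u m) <= geo m + geo m - (geo n + geo n).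
Proof.
move=> um; apply: leq_ind => [|n mn IH]; first by rewrite !subrr rnorm0.
by have := rnorm_dist (u n) (u n.+1) (u m); have := um n mn; have := geoS n; lra.
Qed.

Lemma fast_dist u : fast u ->
  forall m n, (m <= n)%N -> rnorm (u n - u m) <= geo m + geo m - (geo n + geo n).
Proof. by move=> fu m; apply: geo_dist => n _; exact: fu. Qed.

Lemma geo_cvg (u : nat -> V) l :
  (forall n, rnorm (l - u n) <= geo n + geo n) -> u @ \oo --> l.
Proof.
move=> ul; apply/cvg_rnormP => e e0.
have [N NP] := @geo_lt (e / 2%:R) ltac:(lra).
by exists N => n /NP; have := ul n; lra.
Qed.

Lemma fast_complete :
  (forall u, fast u -> exists l : V, u @ \oo --> l) ->
  forall F : set_system V, ProperFilter F -> cauchy F -> cvg F.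
Proof.
move=> H F FF /cauchyP Fc.
(* Any two members of the proper filter [F] meet, so consecutive centres, with radii 2^-(n+2) and
   2^-(n+3), are less than 2^-n apart. *)
have ex n : {x : V | F (ball x (geo n.+2)%:C)}.
  by apply: cid; apply: Fc; rewrite ltcR geo_gt0.
pose u n := sval (ex n); have uP n : F (ball (u n) (geo n.+2)%:C) := svalP (ex n).
have [|l lP] := H u.
  move=> n; have [x []] := filter_ex (filterI (uP n.+1) (uP n)).
  rewrite -!ball_normE/= !normc_lt => x1 x2.
  have := rnorm_dist x (u n.+1) (u n); rewrite (rnormBC x (u n)).
  have := geoS n; have := geoS n.+1; have := geoS n.+2.
  by have := geo_gt0 n.+3; lra.
apply/cvg_ex; exists l; apply/cvgrPdist_lt => _ /posc_real[e e0 ->].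
have [N NP] := @geo_lt (e / 2%:R) ltac:(lra).
have [M MP] := (cvg_rnormP _ _).1 lP (e / 2%:R) ltac:(lra).
apply: filterS (uP (maxn M N)) => x; rewrite -ball_normE/= !normc_lt => ux.
have := NP _ (leq_trans (leq_maxr M N) (leq_trans (leqnSn _) (leqnSn _))).
have := MP _ (leq_maxl M N); have := rnorm_dist (u (maxn M N)) l x; lra.
Qed.

End Geometric.
Arguments geo {R} n.

Section Complete.
Variables (R : realType) (V : completeNormedModType R[i]).

Lemma cauchy_seq_cvg (u : nat -> V) :
  (forall e : R, 0 < e ->
    exists N, forall n, (N <= n)%N -> rnorm (u n - u N) <= e) ->
  exists l : V, u @ \oo --> l.
Proof.
move=> uC; suff /cauchy_cvgP/cvg_ex : cauchy (u @ \oo) by [].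
apply/cauchyP => _ /posc_real[e e0 ->].
have [|N NP] := uC (e / 2%:R); first by lra.
exists (u N); exists N => // n /= /NP; rewrite -ball_normE/= normc_lt rnormBC.
by lra.
Qed.

Lemma fast_cvg (u : nat -> V) : fast u ->
  exists2 l : V, u @ \oo --> l & forall n, rnorm (l - u n) <= geo n + geo n.
Proof.
move=> fu.
have [l ul] : exists l : V, u @ \oo --> l.
  apply: cauchy_seq_cvg => e e0.
  have [N /(_ _ (leqnn N)) Ne] := @geo_lt _ (e / 2%:R) ltac:(lra).
  exists N => n /(fast_dist fu); have := @geo_gt0 R n; lra.
exists l => // n; apply/ler_addgt0Pr => e e0.
have [N NP] := (cvg_rnormP _ _).1 ul e e0.
have := NP _ (leq_maxl N n); have := fast_dist fu (leq_maxr N n).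
have := @geo_gt0 R (maxn N n); have := rnorm_dist (u (maxn N n)) l (u n); lra.
Qed.

End Complete.

Section StarHom.
Variables (R : realType) (A B C : starLmodType R).

Section Linearity.
Variables (f : A -> B) (hf : star_hom f).

Lemma star_homD x y : f (x + y) = f x + f y.
Proof. by have := star_hom_linear hf 1 x y; rewrite !scale1r. Qed.

Lemma star_hom0 : f 0 = 0.
Proof. by apply: (@addrI _ (f 0)); rewrite -star_homD !addr0. Qed.

Lemma star_homZ a x : f (a *: x) = a *: f x.
Proof. by have := star_hom_linear hf a x 0; rewrite star_hom0 !addr0. Qed.

Lemma star_homN x : f (- x) = - f x.
Proof. by rewrite -scaleN1r star_homZ scaleN1r. Qed.

Lemma star_homB x y : f (x - y) = f x - f y.
Proof. by rewrite star_homD star_homN. Qed.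

End Linearity.

Lemma star_hom_id : star_hom (@id A).
Proof. by split. Qed.

Lemma star_hom_comp (g : B -> C) (f : A -> B) :
  star_hom g -> star_hom f -> star_hom (g \o f).
Proof.
move=> hg hf; split=> [a x y|x y|x] /=.
- by rewrite (star_hom_linear hf) (star_hom_linear hg).
- by rewrite (star_homM hf) (star_homM hg).
- by rewrite (star_homV hf) (star_homV hg).
Qed.

Lemma star_hom_cancel (f : A -> B) (g : B -> A) :
  star_hom f -> cancel f g -> cancel g f -> star_hom g.
Proof.
move=> hf fK gK; split=> [a x y|x y|x]; apply: (can_inj fK).
- by rewrite (star_hom_linear hf) !gK.
- by rewrite (star_homM hf) !gK.
- by rewrite (star_homV hf) !gK.
Qed.

End StarHom.

Section CstarNorm.
Variables (R : realType) (A : cstarType R).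
Implicit Types (x y : A) (e : R).

Lemma amulNl x y : amul (- x) y = - amul x y.
Proof. by rewrite -scaleN1r amulZl scaleN1r. Qed.

Lemma amulNr x y : amul x (- y) = - amul x y.
Proof. by rewrite -scaleN1r amulZr scaleN1r. Qed.

Lemma amulBl x y z : amul (x - y) z = amul x z - amul y z.
Proof. by rewrite amulDl amulNl. Qed.

Lemma amulBr x y z : amul z (x - y) = amul z x - amul z y.
Proof. by rewrite amulDr amulNr. Qed.

Lemma amul0l x : amul 0 x = 0.
Proof. by rewrite -{1}(subrr x) amulBl subrr. Qed.

Lemma amul0r x : amul x 0 = 0.
Proof. by rewrite -{1}(subrr x) amulBr subrr. Qed.

Lemma astarN x : astar (- x) = - astar x.
Proof. by rewrite -scaleN1r astarZ rmorphN1 scaleN1r. Qed.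

Lemma astarB x y : astar (x - y) = astar x - astar y.
Proof. by rewrite astarD astarN. Qed.

Lemma astar0 : astar (0 : A) = 0.
Proof. by rewrite -{1}(subrr (0 : A)) astarB subrr. Qed.

Lemma rnormM x y : rnorm (amul x y) <= rnorm x * rnorm y.
Proof. by rewrite -lecR rmorphM/= !rnormE normaM. Qed.

Lemma rnormCstar x : rnorm (amul (astar x) x) = rnorm x ^+ 2.
Proof. by apply: complexI; rewrite rmorphXn/= !rnormE normCstar. Qed.

Lemma rnorm_star x : rnorm (astar x) = rnorm x.
Proof.
(* Divide |y|^2 = |y* y| <= |y*| |y| by |y|; the case of [astar y] is the converse inequality. *)
have le y : rnorm y <= rnorm (astar y).
  have [->|y0] := eqVneq (rnorm y) 0; first exact: rnorm_ge0.
  have {y0} : 0 < rnorm y by rewrite lt_def y0 rnorm_ge0.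
  by move=> y0; rewrite -(ler_pM2r y0) -expr2 -rnormCstar rnormM.
by apply/eqP; rewrite eq_le le -{2}[x]astarK le.
Qed.

Lemma rnorm_amulB_le x y u v d : rnorm (x - u) <= d -> rnorm (y - v) <= d ->
  d <= 1 -> rnorm (amul x y - amul u v) <= d * (rnorm x + rnorm y + 1).
Proof.
move=> xu yv d1.
have := rnorm_dist (amul u y) (amul x y) (amul u v); rewrite -amulBl -amulBr.
have := rnormM (x - u) y; have := rnormM u (y - v).
have := rnorm_le_dist u x; rewrite rnormBC.
have := rnorm_ge0 x; have := rnorm_ge0 y; have := rnorm_ge0 u.
have := rnorm_ge0 (x - u); have := rnorm_ge0 (y - v); nra.
Qed.

Lemma amul_near x y e : 0 < e -> exists2 d : R, 0 < d &
  forall u v, rnorm (x - u) < d -> rnorm (y - v) < d ->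
    rnorm (amul x y - amul u v) < e.
Proof.
move=> e0; set M := rnorm x + rnorm y + 1.
have M0 : 0 < M by rewrite /M; have := rnorm_ge0 x; have := rnorm_ge0 y; lra.
exists (Num.min 1 (e / 2%:R / M)).
  by rewrite lt_min ltr01 !divr_gt0.
move=> u v xu yv.
apply: (@le_lt_trans _ _ (Num.min 1 (e / 2%:R / M) * M)).
  by apply: rnorm_amulB_le (ltW xu) (ltW yv) _; rewrite ge_min lexx.
apply: (@le_lt_trans _ _ (e / 2%:R)); last by lra.
by rewrite -ler_pdivlMr// ge_min lexx orbT.
Qed.

Lemma cvg_amul (u v : nat -> A) x y : u @ \oo --> x -> v @ \oo --> y ->
  (fun n => amul (u n) (v n)) @ \oo --> amul x y.
Proof.
move=> /cvg_rnormP ux /cvg_rnormP vy; apply/cvg_rnormP => e /(amul_near x y)[d d0 H].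
have [[M MP] [N NP]] := (ux d d0, vy d d0).
by exists (maxn M N) => n; rewrite geq_max => /andP[/MP Mn /NP Nn]; exact: H.
Qed.

Lemma cvg_astar (u : nat -> A) x : u @ \oo --> x ->
  (fun n => astar (u n)) @ \oo --> astar x.
Proof.
move=> /cvg_rnormP ux; apply/cvg_rnormP => e /ux[N NP].
by exists N => n /NP; rewrite -astarB rnorm_star.
Qed.

End CstarNorm.

(** * Contractivity of morphisms, without spectral theory *)

Section Contraction.
Variable R : realType.

(* [1 - k] plays the role of [sqrt (1 - h^2)]. *)
Lemma cstar_sqrt (A : cstarType R) (h : A) :
  astar h = h -> rnorm h <= 2%:R^-1 ->
  exists k : A, [/\ astar k = k, amul h k = amul k h &
    k + k = amul h h + amul k k].
Proof.
move=> hs h1; pose half : R[i] := (2%:R^-1 : R)%:C.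
(* The required relation, which says (1 - k)^2 = 1 - h^2, is the fixed point equation of [F]. As |h|
   <= 1/2, the ball of radius 1/4 is stable under [F], and [F] shrinks distances there by a factor
   1/2 or better, so the iterates from 0 converge. All of them are self-adjoint and commute with
   [h]. *)
pose F k := half *: (amul h h + amul k k).
pose k_ n := iter n F 0.
have rh (x : A) : rnorm (half *: x) = rnorm x / 2%:R.
  by rewrite rnormZr ger0_norm ?invr_ge0// mulrC.
have hh : rnorm (amul h h) <= 4%:R^-1.
  by have := rnormM h h; have := rnorm_ge0 h; nra.
have kn n : rnorm (k_ n) <= 4%:R^-1.
  elim: n => [|n IH]; first by rewrite rnorm0; lra.
  rewrite /= rh; have := rnormD (amul h h) (amul (k_ n) (k_ n)).
  by have := rnormM (k_ n) (k_ n); have := rnorm_ge0 (k_ n); nra.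
have FB k l : rnorm k <= 4%:R^-1 -> rnorm l <= 4%:R^-1 ->
    rnorm (F k - F l) <= rnorm (k - l) / 2%:R.
  move=> k1 l1; rewrite /F -scalerBr rh opprD addrACA subrr add0r.
  have := rnorm_dist (amul k l) (amul k k) (amul l l); rewrite -amulBl -amulBr.
  have := rnormM (k - l) l; have := rnormM k (k - l); have := rnorm_ge0 (k - l).
  have := rnorm_ge0 k; have := rnorm_ge0 l; nra.
have kf : fast k_.
  elim=> [|n IH]; last first.
    have := FB _ _ (kn n.+1) (kn n); rewrite [geo _]/geo exprS invfM.
    by move: IH; rewrite /geo /=; lra.
  have := kn 1%N; rewrite /= subr0 /geo expr0 invr1; lra.
have [k kk _] := fast_cvg kf.
have ks n : astar (k_ n) = k_ n.
  elim: n => [|n IH]; first by rewrite astar0.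
  by rewrite /= astarZ astarD !astarM hs IH conjc_real.
have kc n : amul h (k_ n) = amul (k_ n) h.
  elim: n => [|n IH]; first by rewrite amul0l amul0r.
  rewrite /= amulZr amulZl amulDl amulDr; congr (_ *: (_ + _)).
    by rewrite amulA.
  by rewrite amulA IH -amulA IH amulA.
have kS : (fun n => k_ n.+1) @ \oo --> k by apply: (cvg_subseq leqnSn kk).
exists k; split.
- apply: (seq_cvg_unique _ kk); have := cvg_astar kk.
  by under eq_fun do rewrite ks.
- apply: (seq_cvg_unique (cvg_amul (cvg_cst h) kk)).
  by under eq_fun do rewrite kc; apply: cvg_amul kk (cvg_cst h).
- have : (fun n => F (k_ n)) @ \oo --> F k.
    by apply: cvgZ; [exact: cvg_cst|apply: cvgD; [exact: cvg_cst|exact: cvg_amul]].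
  move=> /(seq_cvg_unique kS) kF; rewrite {1 2}kF /F -scalerDl -rmorphD/=.
  have -> : 2%:R^-1 + 2%:R^-1 = 1 :> R by lra.
  by rewrite rmorph1 scale1r.
Qed.

(* The multiplier [1 - k + i h] is unitary and [h] is its imaginary part. *)
Lemma cstar_imaginary_part_le1 (B : cstarType R) (h k : B) :
  astar h = h -> astar k = k -> amul h k = amul k h ->
  k + k = amul h h + amul k k -> rnorm h <= 1.
Proof.
move=> hs ks hk kk.
(* Left multiplication by 1 - k + s h, written out because [B] may have no unit. *)
pose U (s : R[i]) b := b - amul k b + s *: amul h b.
have Ustar s b c : conjc s = - s -> amul (astar (U s b)) c = amul (astar b) (U (- s) c).
  move=> si; rewrite /U !astarD astarN astarZ !astarM hs ks si.
  rewrite !amulDl !amulDr amulNl amulNr amulZl amulZr !amulA.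
  by [].
(* Since h and k commute, (1 - k - s h)(1 - k + s h) = (1 - k)^2 + h^2 = 1. *)
have UU s b : s * s = -1 -> U (- s) (U s b) = b.
  move=> si; rewrite /U.
  rewrite !(amulDr, amulNr, amulZr) !amulA hk !(scalerDr, scalerN, scaleNr, scalerA) si.
  rewrite scaleN1r opprK.
  have -> : amul (amul k k) b = amul k b + amul k b - amul (amul h h) b.
    by rewrite -amulDl kk amulDl addrAC subrr add0r.
  set x := amul k b; set y := s *: amul h b; set z := amul (amul h h) b.
  set w := s *: amul (amul k h) b.
  have -> : x - (x + x - z) = z - x.
    by rewrite opprB addrCA opprD [x + _]addrA subrr add0r.
  rewrite !opprK opprD opprB !addrA (addrAC b) subrK.
  by rewrite (addrAC _ (- w)) subrK (addrAC _ (- z)) subrK addrK.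
have Unorm s b : conjc s = - s -> s * s = -1 -> rnorm (U s b) = rnorm b.
  move=> sc si; apply/eqP; rewrite -(@eqrXn2 _ 2) ?rnorm_ge0// -!rnormCstar.
  by rewrite Ustar// UU.
(* The vectors [U 'i b] and [U (- 'i) b] have norm |b|, and their difference is 2i h b. *)
have hb b : rnorm (amul h b) <= rnorm b.
  have i1 : conjc 'i = - 'i :> R[i] by apply/eqP; rewrite eq_complex/= oppr0 !eqxx.
  have i2 : 'i * 'i = -1 :> R[i] by rewrite -expr2 sqr_i.
  have := rnormB (U 'i b) (U (- 'i) b).
  rewrite (Unorm 'i)// (Unorm (- 'i)) ?mulrNN//; last by rewrite rmorphN; congr (- _).
  rewrite /U scaleNr opprD opprK addrACA subrr add0r -mulr2n -scaler_nat scalerA.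
  rewrite rnormZ normrM normr_nat normCi mulr1/=.
  lra.
(* For b = h the bound reads |h|^2 = |h* h| <= |h|. *)
rewrite leNgt; apply/negP => h0.
by have := hb h; rewrite -{1}hs rnormCstar; nra.
Qed.

(** The relations between h and k survive under f, so |f h| <= 1 for self-adjoint h of norm at most
    1/2. Scaling gives |f h| <= 2 |h| for all self-adjoint h, and the C*-identity then removes the
    factor 2. *)
Lemma star_hom_contract (A B : cstarType R) (f : A -> B) x :
  star_hom f -> rnorm (f x) <= rnorm x.
Proof.
move=> hf.
have sa h : astar h = h -> rnorm h <= 2%:R^-1 -> rnorm (f h) <= 1.
  move=> hs /(cstar_sqrt hs)[k [ks hk kk]].
  apply: (@cstar_imaginary_part_le1 _ (f h) (f k)).
  - by rewrite -(star_homV hf) hs.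
  - by rewrite -(star_homV hf) ks.
  - by rewrite -!(star_homM hf) hk.
  - by rewrite -!(star_homM hf) -!(star_homD hf) kk.
have sa2 h : astar h = h -> rnorm (f h) <= 2%:R * rnorm h.
  move=> hs; have [h0|h0] := eqVneq (rnorm h) 0.
    by rewrite (rnorm_eq0 h0) (star_hom0 hf) !rnorm0 mulr0.
  have {}h0 : 0 < rnorm h by rewrite lt_def h0 rnorm_ge0.
  set t := (2%:R * rnorm h)^-1.
  have t0 : 0 < t by rewrite invr_gt0 mulr_gt0.
  have := sa (t%:C *: h).
  rewrite astarZ conjc_real hs (star_homZ hf) !rnormZr gtr0_norm// => /(_ erefl).
  rewrite {1}/t invfM -mulrA mulVf ?gt_eqF// mulr1 lexx mulrC => /(_ isT).
  by rewrite ler_pdivrMr ?mulr_gt0// mul1r.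
(* Passing from x to x* x squares both norms but leaves the factor 2 as it is. *)
have pw n : forall x, rnorm (f x) ^+ (2 ^ n.+1) <= 2%:R * rnorm x ^+ (2 ^ n.+1).
  elim: n => [|n IH] y; last first.
    by rewrite expnS !exprM -!rnormCstar -(star_homV hf) -(star_homM hf).
  rewrite expn1 -!rnormCstar -(star_homV hf) -(star_homM hf) sa2//.
  by rewrite astarM astarK.
rewrite leNgt; apply/negP => lt.
have [x0|x0] := eqVneq (rnorm x) 0.
  by move: lt; rewrite (rnorm_eq0 x0) (star_hom0 hf) !rnorm0 ltxx.
have {}x0 : 0 < rnorm x by rewrite lt_def x0 rnorm_ge0.
(* By Bernoulli's inequality, a ratio |f x| / |x| = 1 + s with s > 0 has unbounded powers, whereas
   [pw] bounds its powers of exponent 2^(n+1) by 2. *)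
have bern (s : R) n : 0 <= s -> 1 + n%:R * s <= (1 + s) ^+ n.
  move=> s0; elim: n => [|n IH]; first by rewrite mul0r addr0 expr0.
  rewrite exprS -natr1; have : 0 <= n%:R :> R by []; nra.
pose s := rnorm (f x) / rnorm x - 1.
have s0 : 0 < s by rewrite subr_gt0 ltr_pdivlMr// mul1r.
have sE n : (1 + s) ^+ (2 ^ n.+1) <= 2%:R.
  by rewrite addrC subrK expr_div_n ler_pdivrMr ?exprn_gt0// pw.
pose n := Num.truncn s^-1.
have ns : s^-1 < (2 ^ n.+1)%:R.
  by apply: lt_trans (truncnS_gt _) _; rewrite ltr_nat ltn_expl.
have := le_trans (bern s (2 ^ n.+1)%N (ltW s0)) (sE n).
have : 1 < s * (2 ^ n.+1)%:R by rewrite -ltr_pdivrMl// mulr1.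
by rewrite (mulrC s); lra.
Qed.

End Contraction.

(** * Bounded products of sequences of algebras *)

Section DependentProduct.
Variables (R : realType) (C : nat -> cstarType R).

Definition dprod := forall n, C n.

HB.instance Definition _ := Choice.on dprod.

Let dadd (x y : dprod) : dprod := fun n => x n + y n.
Let dopp (x : dprod) : dprod := fun n => - x n.
Let dscale (a : R[i]) (x : dprod) : dprod := fun n => a *: x n.

Let daddA : associative dadd.
Proof. by move=> x y z; apply: functional_extensionality_dep => n; exact: addrA. Qed.
Let daddC : commutative dadd.
Proof. by move=> x y; apply: functional_extensionality_dep => n; exact: addrC. Qed.
Let dadd0 : left_id (fun=> 0) dadd.
Proof. by move=> x; apply: functional_extensionality_dep => n; exact: add0r. Qed.
Let daddN : left_inverse (fun=> 0) dopp dadd.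
Proof. by move=> x; apply: functional_extensionality_dep => n; exact: addNr. Qed.

HB.instance Definition _ := GRing.isZmodule.Build dprod daddA daddC dadd0 daddN.

Let dscaleA a b x : dscale a (dscale b x) = dscale (a * b) x.
Proof. by apply: functional_extensionality_dep => n; exact: scalerA. Qed.
Let dscale1 : left_id 1 dscale.
Proof. by move=> x; apply: functional_extensionality_dep => n; exact: scale1r. Qed.
Let dscaleDr : right_distributive dscale +%R.
Proof. by move=> a x y; apply: functional_extensionality_dep => n; exact: scalerDr. Qed.
Let dscaleDl x : {morph dscale^~ x : a b / a + b}.
Proof. by move=> a b; apply: functional_extensionality_dep => n; exact: scalerDl. Qed.

HB.instance Definition _ :=
  GRing.Zmodule_isLmodule.Build R[i] dprod dscaleA dscale1 dscaleDr dscaleDl.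

Definition bounded_seq : {pred dprod} :=
  fun x => `[< exists M, forall n, rnorm (x n) <= M >].

Let bounded_submod : submod_closed bounded_seq.
Proof.
split; first by apply/asboolP; exists 0 => n; rewrite rnorm0.
move=> a x y /asboolP[M xM] /asboolP[N yN]; apply/asboolP.
exists (complex.Re `|a| * M + N) => n.
apply: le_trans (rnormD _ _) _; rewrite rnormZ lerD// ler_wpM2l//.
exact: (rnorm_ge0 (a : R[i]^o)).
Qed.

HB.instance Definition _ :=
  GRing.isSubmodClosed.Build R[i] dprod bounded_seq bounded_submod.

(** The l^infinity product of the C n, normed by the supremum of the coordinate norms; [dprod] only
    supplies the ambient vector space. *)
Definition bprod := {x : dprod | x \in bounded_seq}.

HB.instance Definition _ := [isSub of bprod for @sval _ _].
HB.instance Definition _ := [Choice of bprod by <:].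
HB.instance Definition _ := [SubChoice_isSubLmodule of bprod by <:].

Definition bcoord (n : nat) (x : bprod) : C n := val x n.

Let supnorm (x : bprod) : R := sup (range (fun n => rnorm (bcoord n x))).

Let bcoord_le x n : rnorm (bcoord n x) <= supnorm x.
Proof.
apply: ub_le_sup; last by exists n.
have /asboolP[M xM] := valP x.
by exists M => _ [m _ <-]; exact: xM.
Qed.

Let supnorm_le x M : (forall n, rnorm (bcoord n x) <= M) -> supnorm x <= M.
Proof.
move=> xM; apply: ge_sup => [|_ [n _ <-]//].
by exists (rnorm (bcoord 0 x)); exists 0%N.
Qed.

Let bnorm x : R[i] := (supnorm x)%:C.

Let bnormD x y : bnorm (x + y) <= bnorm x + bnorm y.
Proof.
rewrite /bnorm -rmorphD lecR; apply: supnorm_le => n.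
apply: le_trans (rnormD (bcoord n x) (bcoord n y)) _; rewrite lerD//; exact: bcoord_le.
Qed.

Let bnormZ (a : R[i]) x : bnorm (a *: x) = `|a| * bnorm x.
Proof.
pose r := complex.Re `|a|; have aE : `|a| = r%:C.
  by rewrite /r RRe_real// ger0_real.
have r0 : 0 <= r by rewrite -lecR -aE normr_ge0.
rewrite /bnorm aE -rmorphM; congr _%:C; apply/eqP; rewrite eq_le; apply/andP; split.
  by apply: supnorm_le => n; rewrite [rnorm _]rnormZ ler_wpM2l//; exact: bcoord_le.
have [->|rn0] := eqVneq r 0.
  by rewrite mul0r; apply: le_trans (bcoord_le _ 0); exact: rnorm_ge0.
have {}r0 : 0 < r by rewrite lt_def rn0.
rewrite mulrC -ler_pdivlMr//; apply: supnorm_le => n.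
by rewrite ler_pdivlMr// mulrC -rnormZ; exact: (bcoord_le (a *: x)).
Qed.

Let bnorm0 x : bnorm x = 0 -> x = 0.
Proof.
move=> /complexI x0; apply: val_inj; apply: functional_extensionality_dep => n.
apply: (@rnorm_eq0 _ (C n)); apply/eqP.
by rewrite eq_le rnorm_ge0 andbT -x0; exact: bcoord_le.
Qed.

HB.instance Definition _ := Lmodule_isNormed.Build R[i] bprod bnormD bnormZ bnorm0.

Lemma rnorm_bcoord n x : rnorm (bcoord n x) <= rnorm x.
Proof. exact: bcoord_le. Qed.

Lemma rnorm_bprod_le x M : (forall n, rnorm (bcoord n x) <= M) -> rnorm x <= M.
Proof. exact: supnorm_le. Qed.

Lemma bprod_eq x y : (forall n, bcoord n x = bcoord n y) -> x = y.
Proof. by move=> xy; apply: val_inj; apply: functional_extensionality_dep. Qed.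

Fact mkbprod_subproof (x : dprod) M : (forall n, rnorm (x n) <= M) -> x \in bounded_seq.
Proof. by move=> xM; apply/asboolP; exists M. Qed.

Definition mkbprod (x : dprod) M (xM : forall n, rnorm (x n) <= M) : bprod :=
  Sub x (mkbprod_subproof xM).

Let bprod_complete (F : set_system bprod) : ProperFilter F -> cauchy F -> cvg F.
Proof.
apply: fast_complete => u fu.
have uc n k : rnorm (bcoord n (u k.+1) - bcoord n (u k)) <= geo k.
  by apply: le_trans (fu k); exact: (rnorm_bcoord n (u k.+1 - u k)).
(* The rate of convergence does not depend on the coordinate n, so the coordinatewise limit is a
   limit in the supremum norm. *)
have lim n : {l : C n | forall k, rnorm (l - bcoord n (u k)) <= geo k + geo k}.
  by apply: cid; have [l _ lP] := fast_cvg (uc n); exists l.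
have lM n : rnorm (sval (lim n)) <= rnorm (u 0) + (geo 0 + geo 0).
  apply: le_trans (rnorm_le_dist _ (bcoord n (u 0))) _.
  by rewrite lerD ?rnorm_bcoord//; exact: (svalP (lim n)).
exists (mkbprod lM); apply: geo_cvg => k.
by apply: rnorm_bprod_le => n; exact: (svalP (lim n)).
Qed.

HB.instance Definition _ := Uniform_isComplete.Build bprod bprod_complete.

Let mulM (x y : bprod) n : rnorm (amul (bcoord n x) (bcoord n y)) <= rnorm x * rnorm y.
Proof.
by apply: le_trans (rnormM _ _) _; rewrite ler_pM ?rnorm_ge0 ?rnorm_bcoord.
Qed.

Let starM (x : bprod) n : rnorm (astar (bcoord n x)) <= rnorm x.
Proof. by rewrite rnorm_star rnorm_bcoord. Qed.

Let bmul x y : bprod := mkbprod (mulM x y).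
Let bstar x : bprod := mkbprod (starM x).

HB.instance Definition _ := hasMulStar.Build bprod bmul bstar.

Let bmulA (x y z : bprod) : amul x (amul y z) = amul (amul x y) z.
Proof. by apply: bprod_eq => n; exact: amulA. Qed.
Let bmulDl (x y z : bprod) : amul (x + y) z = amul x z + amul y z.
Proof. by apply: bprod_eq => n; exact: amulDl. Qed.
Let bmulDr (x y z : bprod) : amul x (y + z) = amul x y + amul x z.
Proof. by apply: bprod_eq => n; exact: amulDr. Qed.
Let bmulZl (a : R[i]) (x y : bprod) : amul (a *: x) y = a *: amul x y.
Proof. by apply: bprod_eq => n; exact: amulZl. Qed.
Let bmulZr (a : R[i]) (x y : bprod) : amul x (a *: y) = a *: amul x y.
Proof. by apply: bprod_eq => n; exact: amulZr. Qed.
Let bstarK (x : bprod) : astar (astar x) = x.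
Proof. by apply: bprod_eq => n; exact: astarK. Qed.
Let bstarD (x y : bprod) : astar (x + y) = astar x + astar y.
Proof. by apply: bprod_eq => n; exact: astarD. Qed.
Let bstarZ (a : R[i]) (x : bprod) : astar (a *: x) = conjc a *: astar x.
Proof. by apply: bprod_eq => n; exact: astarZ. Qed.
Let bstarM (x y : bprod) : astar (amul x y) = amul (astar y) (astar x).
Proof. by apply: bprod_eq => n; exact: astarM. Qed.
Let bnormM (x y : bprod) : `|amul x y| <= `|x| * `|y|.
Proof. by rewrite -!rnormE -rmorphM lecR; apply: rnorm_bprod_le => n; exact: mulM. Qed.
Let bnormC (x : bprod) : `|amul (astar x) x| = `|x| ^+ 2.
Proof.
rewrite -!rnormE -rmorphXn; congr _%:C; apply/eqP; rewrite eq_le; apply/andP; split.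
  apply: rnorm_bprod_le => n; rewrite [rnorm _]rnormCstar.
  by rewrite lerXn2r ?nnegrE ?rnorm_ge0 ?rnorm_bcoord.
rewrite -[leRHS]sqr_sqrtr ?rnorm_ge0// lerXn2r ?nnegrE ?rnorm_ge0 ?sqrtr_ge0//.
apply: rnorm_bprod_le => n; rewrite -[leLHS]ger0_norm ?rnorm_ge0// -sqrtr_sqr ler_wsqrtr//.
rewrite -rnormCstar; exact: (rnorm_bcoord n (amul (astar x) x)).
Qed.

HB.instance Definition _ := isCstarAlgebra.Build R bprod
  bmulA bmulDl bmulDr bmulZl bmulZr bstarK bstarD bstarZ bstarM bnormM bnormC.

Lemma bcoord_star_hom n : star_hom (bcoord n : bprod -> C n).
Proof. by split. Qed.

End DependentProduct.
Arguments bcoord_star_hom {R C} n.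

(** The conditions of [subCstar] apart from closedness, for subalgebras that are still to be closed
    up. *)
Record star_subset (R : realType) (A : cstarType R) (S : set A) : Prop := StarSubset {
  star_subset0 : S 0;
  star_subsetD : forall x y, S x -> S y -> S (x + y);
  star_subsetZ : forall (a : R[i]) x, S x -> S (a *: x);
  star_subsetM : forall x y, S x -> S y -> S (amul x y);
  star_subsetV : forall x, S x -> S (astar x)
}.

Section Closure.
Variables (R : realType) (A : cstarType R) (S : set A) (hS : star_subset S).

Let cS := closure S.

Let cS0 : cS 0.
Proof. by apply: subset_closure; exact: star_subset0. Qed.

Let cSD x y : cS x -> cS y -> cS (x + y).
Proof.
move=> /closure_rnormP Sx /closure_rnormP Sy; apply/closure_rnormP => e e0.
have [|u Su xu] := Sx (e / 2%:R); first by lra.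
have [|v Sv yv] := Sy (e / 2%:R); first by lra.
exists (u + v); first exact: star_subsetD.
by rewrite opprD addrACA (le_lt_trans (rnormD _ _))//; lra.
Qed.

Let cSZ (a : R[i]) x : cS x -> cS (a *: x).
Proof.
move=> /closure_rnormP Sx; apply/closure_rnormP => e e0.
pose r := complex.Re `|a|.
have r0 : 0 <= r := rnorm_ge0 (a : R[i]^o).
have [|u Su xu] := Sx (e / (r + 1)); first by rewrite divr_gt0//; lra.
exists (a *: u); first exact: star_subsetZ.
rewrite -scalerBr rnormZ -/r.
move: xu; rewrite ltr_pdivlMr; last by lra.
have := rnorm_ge0 (x - u); nra.
Qed.

Let cSM x y : cS x -> cS y -> cS (amul x y).
Proof.
move=> /closure_rnormP Sx /closure_rnormP Sy; apply/closure_rnormP => e.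
move=> /(amul_near x y)[d d0 dP].
have [[u Su xu] [v Sv yv]] := (Sx d d0, Sy d d0).
by exists (amul u v); [exact: star_subsetM|exact: dP].
Qed.

Let cSV x : cS x -> cS (astar x).
Proof.
move=> /closure_rnormP Sx; apply/closure_rnormP => e /Sx[u Su xu].
by exists (astar u); [exact: star_subsetV|rewrite -astarB rnorm_star].
Qed.

Definition sub_closure : subCstar A :=
  SubCstar (@closed_closure _ S) cS0 cSD cSZ cSM cSV.

End Closure.

Section SubAlg.
Variables (R : realType) (A : cstarType R) (B : subCstar A).

Lemma rnorm_val (x : sub_alg B) : rnorm (val x) = rnorm x.
Proof. by []. Qed.

Lemma val_star_hom : star_hom (val : sub_alg B -> A).
Proof. by split. Qed.

Lemma sub_algP (x : sub_alg B) : sub_set B (val x).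
Proof. by move/asboolP: (valP x). Qed.

Fact mksub_subproof x : sub_set B x -> x \in in_sub B.
Proof. by move=> Bx; apply/asboolP. Qed.

Definition mksub x (Bx : sub_set B x) : sub_alg B := Sub x (mksub_subproof Bx).

End SubAlg.

Lemma finite_eventually (T : choiceType) (F : set T) (P : T -> nat -> Prop) :
  finite_set F ->
  (forall x, F x -> exists N, forall n, (N <= n)%N -> P x n) ->
  exists N, forall n, (N <= n)%N -> forall x, F x -> P x n.
Proof.
move=> /finite_seqP[s ->]; elim: s => [|a s IH] H; first by exists 0%N.
have [|N NP] := IH; first by move=> x /= xs; apply: H; rewrite /= inE xs orbT.
have [|M MP] := H a; first by rewrite /= inE eqxx.
exists (maxn M N) => n; rewrite geq_max => /andP[/MP Mn /NP Nn] x /=.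
by rewrite inE => /orP[/eqP->|/Nn].
Qed.

(** * Maps out of and onto quotients *)

Section QuotientMaps.
Variables (R : realType) (A : cstarType R) (J : ideal A).

Lemma cquot_norm_lt (q : cquot J) e : cquot_norm q < e ->
  exists2 z : A, \pi_(cquot J) z = q & rnorm z < e.
Proof.
move=> /inf_lt[|_ [z /= zq <-] ze]; last by exists z.
by exists (rnorm (repr q)); exists (repr q) => //=; rewrite reprK.
Qed.

Lemma cquot_norm_pi (z : A) : cquot_norm (\pi_(cquot J) z) <= rnorm z.
Proof. by apply: ge_inf; [exists 0 => _ [y _ <-]; exact: rnorm_ge0|exists z]. Qed.

Lemma cquot_pi_linear : linear (\pi_(cquot J) : A -> cquot J).
Proof. by move=> a x y; rewrite cquot_piD cquot_piZ. Qed.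

Lemma cquot_piB (x y : A) : \pi_(cquot J) (x - y) = \pi_(cquot J) x - \pi_(cquot J) y.
Proof. by rewrite -(scaleN1r y) addrC cquot_pi_linear scaleN1r addrC. Qed.

Lemma cquot_pi_eq0 (x : A) : \pi_(cquot J) x = 0 <-> ideal_set J x.
Proof.
have <- : \pi_(cquot J) (0 : A) = 0 by rewrite -(subrr 0) cquot_piB subrr.
by rewrite cquot_piP subr0.
Qed.

Lemma cquot_pi_star_hom : (forall x, ideal_set J x -> ideal_set J (astar x)) ->
  star_hom (\pi_(cquot J) : A -> cquot J).
Proof.
move=> JV; split=> [|x y|x]; first exact: cquot_pi_linear.
- apply/cquot_piP; set u := repr _; set v := repr _.
  have -> : amul x y - amul u v = amul (x - u) y + amul u (y - v).
    by rewrite amulBl amulBr addrA subrK.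
  have JB w : ideal_set J (w - repr (\pi_(cquot J) w)).
    by apply/cquot_piP; rewrite reprK.
  by apply: ideal_setD; [apply: ideal_setMr|apply: ideal_setMl]; exact: JB.
- by apply/cquot_piP; rewrite -astarB; apply: JV; apply/cquot_piP; rewrite reprK.
Qed.

Variables (B : starLmodType R) (f : A -> B).
Hypotheses (hf : star_hom f) (f0 : forall x, ideal_set J x -> f x = 0).

Definition cquot_lift (q : cquot J) : B := f (repr q).

Lemma cquot_liftE x : cquot_lift (\pi_(cquot J) x) = f x.
Proof.
by apply/eqP; rewrite -subr_eq0 -(star_homB hf); apply/eqP/f0; exact: cquot_repr.
Qed.

Lemma cquot_lift_star_hom : star_hom cquot_lift.
Proof.
split=> [a x y|x y|x].
- rewrite -[x in LHS]reprK -[y in LHS]reprK -cquot_pi_linear cquot_liftE.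
  exact: star_hom_linear.
- by rewrite cquot_liftE (star_homM hf).
- by rewrite cquot_liftE (star_homV hf).
Qed.

End QuotientMaps.

(** * Sequence algebras modulo null sequences *)

Section Truncation.
Variables (R : realType) (D : nat -> cstarType R).

Fact trunc_subproof k (x : bprod D) n :
  rnorm (if (n < k)%N then bcoord n x else 0) <= rnorm x.
Proof. by case: ifP => _; rewrite ?rnorm_bcoord// rnorm0 rnorm_ge0. Qed.

Definition trunc k (x : bprod D) : bprod D := mkbprod (trunc_subproof k x).

Lemma bcoord_trunc k x n : bcoord n (trunc k x) = if (n < k)%N then bcoord n x else 0.
Proof. by []. Qed.

Lemma trunc_star_hom k : star_hom (trunc k).
Proof.
by split=> [a x y|x y|x]; apply: bprod_eq => n; rewrite !bcoord_trunc;
  rewrite !(star_hom_linear (bcoord_star_hom n), star_homM (bcoord_star_hom n),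
            star_homV (bcoord_star_hom n)) !bcoord_trunc; case: ifP => _ //;
  rewrite ?scaler0 ?addr0 ?amul0l ?astar0.
Qed.

Variable E : subCstar (bprod D).
Hypothesis truncE : forall k x, sub_set E x -> sub_set E (trunc k x).

Definition ev n (x : sub_alg E) : D n := bcoord n (val x).

Lemma ev_star_hom n : star_hom (ev n).
Proof. exact: star_hom_comp (bcoord_star_hom n) (val_star_hom E). Qed.

Lemma rnorm_ev n x : rnorm (ev n x) <= rnorm x.
Proof. exact: rnorm_bcoord. Qed.

Let tail0 k : set (sub_alg E) := [set x | forall n, (k <= n)%N -> ev n x = 0].

Let tail0_closed k : closed (tail0 k).
Proof.
apply: closed_rnormP => x xS n kn; apply: rnorm_eq0; apply/eqP.
rewrite eq_le rnorm_ge0 andbT; apply/ler_addgt0Pr => e /xS[y /(_ n kn) y0 xy].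
have := rnorm_ev n (x - y); rewrite (star_homB (ev_star_hom n)) y0 subr0; lra.
Qed.

Let tail00 k : tail0 k 0.
Proof. by move=> n _; rewrite (star_hom0 (ev_star_hom n)). Qed.
Let tail0D k x y : tail0 k x -> tail0 k y -> tail0 k (x + y).
Proof. by move=> x0 y0 n kn; rewrite (star_homD (ev_star_hom n)) x0// y0// addr0. Qed.
Let tail0Z k (a : R[i]) x : tail0 k x -> tail0 k (a *: x).
Proof. by move=> x0 n kn; rewrite (star_homZ (ev_star_hom n)) x0// scaler0. Qed.
Let tail0Ml k a x : tail0 k x -> tail0 k (amul a x).
Proof. by move=> x0 n kn; rewrite (star_homM (ev_star_hom n)) x0// amul0r. Qed.
Let tail0Mr k a x : tail0 k x -> tail0 k (amul x a).
Proof. by move=> x0 n kn; rewrite (star_homM (ev_star_hom n)) x0// amul0l. Qed.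

Definition tail_ideal k : ideal (sub_alg E) :=
  Ideal (@tail0_closed k) (@tail00 k) (@tail0D k) (@tail0Z k) (@tail0Ml k) (@tail0Mr k).

Lemma tail_idealS k : tail_ideal k `<=` tail_ideal k.+1.
Proof. by move=> x x0 n /ltnW/x0. Qed.

Definition null_ideal : ideal (sub_alg E) := ideal_closure_union tail_idealS.

(** A null sequence is the limit of its truncations, which lie in [E] by [truncE] and in some
    [tail_ideal]. *)
Lemma null_idealP x : ideal_set null_ideal x <->
  forall e, 0 < e -> exists N, forall n, (N <= n)%N -> rnorm (ev n x) < e.
Proof.
split=> [/closure_rnormP Jx e /Jx[y [k _ Jy] xy]|H].
  exists k => n /Jy y0; apply: le_lt_trans xy.
  have := rnorm_ev n (x - y); rewrite (star_homB (ev_star_hom n)) y0 subr0.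
  exact.
apply/closure_rnormP => e e0.
have [|N NP] := H (e / 2%:R); first by lra.
exists (mksub (truncE N (sub_algP x))).
  by exists N => // n Nn; rewrite /ev bcoord_trunc ltnNge Nn.
apply: (@le_lt_trans _ _ (e / 2%:R)); last by lra.
apply: rnorm_bprod_le => n; rewrite (star_homB (bcoord_star_hom n)) bcoord_trunc.
case: ltnP => [_|/NP/ltW]; last by rewrite subr0.
by rewrite subrr rnorm0; lra.
Qed.

Lemma null_idealV x : ideal_set null_ideal x -> ideal_set null_ideal (astar x).
Proof.
move=> /null_idealP H; apply/null_idealP => e /H[N NP].
by exists N => n /NP; rewrite (star_homV (ev_star_hom n)) rnorm_star.
Qed.

(** The common core of both lifts. Weak semiprojectivity replaces [sigma] by a morphism into the
    quotient by some [tail_ideal k], and on that quotient the coordinate n is well defined for n >=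
    k. The map [s] is any lift of [sigma] to sequences; it need not be a morphism and only serves to
    compare coordinates. *)
Lemma weakly_semiprojective_lift (C : cstarType R) (sigma : C -> cquot null_ideal)
    (s : C -> sub_alg E) (F : set C) (e : R) :
  weakly_semiprojective C -> star_hom sigma ->
  (forall c, \pi_(cquot null_ideal) (s c) = sigma c) ->
  finite_set F -> 0 < e ->
  exists N, forall n, (N <= n)%N -> exists2 psi : C -> D n, star_hom psi &
    forall x, F x -> rnorm (psi x - ev n (s x)) < e.
Proof.
move=> Cw sh sE finF e0.
have [|k [psi [hpsi psiE]]] := Cw _ _ tail_idealS sigma (e / 2%:R) F sh _ finF.
  by lra.
pose psi_ n c := cquot_lift (ev n) (psi c).
have [|N NP] := @finite_eventually _ F
    (fun x n => rnorm (psi_ n x - ev n (s x)) < e) finF.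
  move=> x /psiE/cquot_norm_lt[z zE ze].
  (* The class of [repr (psi x) - s x] has small norm, hence a representative [z] that is small in
     every coordinate; what is left is a null sequence, small from some index on. *)
  have /null_idealP/(_ (e / 2%:R)) : ideal_set null_ideal (repr (psi x) - s x - z).
    apply/cquot_pi_eq0; rewrite !cquot_piB zE sE /cquot_map.
    exact: subrr.
  case=> [|N NP]; first by lra.
  exists N => n /NP; rewrite !(star_homB (ev_star_hom n)).
  have := rnorm_ev n z; rewrite /psi_ /cquot_lift.
  have := rnorm_le_dist (ev n (repr (psi x)) - ev n (s x)) (ev n z).
  lra.
exists (maxn k N) => n; rewrite geq_max => /andP[kn Nn].
exists (psi_ n); last exact: NP.
(* [ev n] kills [tail_ideal k] because k <= n. *)
apply: star_hom_comp hpsi; apply: cquot_lift_star_hom (ev_star_hom n) _.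
by move=> x; apply.
Qed.

End Truncation.
Arguments ev_star_hom {R D E} n.

(** * The quotient norm and quotient algebras *)

Section QuotientNorm.
Variables (R : realType) (A : cstarType R) (J : ideal A).
Implicit Types q r : cquot J.

Lemma cquot_norm_lift q (e : R) : 0 < e ->
  exists2 z : A, \pi_(cquot J) z = q & rnorm z < cquot_norm q + e.
Proof. by move=> e0; apply: cquot_norm_lt; rewrite ltrDl. Qed.

Lemma cquot_norm_ge0 q : 0 <= cquot_norm q.
Proof.
apply: lb_le_inf => [|_ [z _ <-]]; last exact: rnorm_ge0.
by exists (rnorm (repr q)), (repr q) => //=; rewrite reprK.
Qed.

Lemma cquot_normD q r : cquot_norm (q + r) <= cquot_norm q + cquot_norm r.
Proof.
apply/ler_addgt0Pr => e e0; have e20 : 0 < e / 2%:R by lra.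
have [[x <- xe] [y <- ye]] := (cquot_norm_lift q e20, cquot_norm_lift r e20).
rewrite -cquot_piD; have := cquot_norm_pi J (x + y); have := rnormD x y; lra.
Qed.

Lemma cquot_normZ (a : R[i]) q : cquot_norm (a *: q) = complex.Re `|a| * cquot_norm q.
Proof.
have le (b : R[i]) r : cquot_norm (b *: r) <= complex.Re `|b| * cquot_norm r.
  have b0 : 0 <= complex.Re `|b| := rnorm_ge0 (b : R[i]^o).
  apply/ler_addgt0Pr => e e0.
  have [|z <- ze] := @cquot_norm_lift r (e / (complex.Re `|b| + 1)).
    by rewrite divr_gt0//; lra.
  have -> : b *: \pi_(cquot J) z = \pi_(cquot J) (b *: z) by rewrite cquot_piZ.
  apply: le_trans (cquot_norm_pi _ _) _; rewrite rnormZ.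
  move: ze; rewrite -ltrBlDl ltr_pdivlMr; last by lra.
  set m := cquot_norm _; have := cquot_norm_pi J z; rewrite -/m; nra.
have [->|a0] := eqVneq a 0.
  rewrite scale0r normr0/= mul0r; apply/eqP; rewrite eq_le cquot_norm_ge0 andbT.
  by have := le 0 0; rewrite scale0r normr0/= mul0r.
apply/eqP; rewrite eq_le le/=.
have na : 0 < complex.Re `|a|.
  by rewrite -ltcR RRe_real ?normr_gt0// ger0_real.
(* The reverse inequality is [le] for the inverse scalar. *)
have := le a^-1 (a *: q); rewrite scalerA mulVf// scale1r.
have -> : complex.Re `|a^-1| = (complex.Re `|a|)^-1.
  by rewrite -[`|a|]RRe_real ?ger0_real// normfV -[`|a|]RRe_real ?ger0_real// -fmorphV.
by rewrite mulrC ler_pdivlMr// mulrC.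
Qed.

Lemma cquot_norm_eq0 q : cquot_norm q = 0 -> q = 0.
Proof.
(* Representatives of arbitrarily small norm exhibit [repr q] as a limit of elements of [J], which
   is closed. *)
move=> q0; rewrite -(reprK q); apply/cquot_pi_eq0.
apply: (@ideal_closed _ _ J); apply/closure_rnormP => e e0.
have [z zq] := cquot_norm_lift q e0; rewrite q0 add0r => ze.
exists (repr q - z); first by apply/cquot_piP; rewrite reprK zq.
by rewrite opprB addrC subrK.
Qed.

End QuotientNorm.

Section CstarQuotient.
Variables (R : realType) (A : cstarType R) (J : ideal A).

(* Both properties hold for every closed two-sided ideal J, by means of an
   approximate unit of J. *)
Record cstar_ideal : Prop := CstarIdeal {
  cstar_idealV : forall x, ideal_set J x -> ideal_set J (astar x);
  cstar_idealC : forall x : A,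
    cquot_norm (\pi_(cquot J) x) ^+ 2 <= cquot_norm (\pi_(cquot J) (amul (astar x) x))
}.

Variable hJ : cstar_ideal.

(** An alias indexed by the proof of [cstar_ideal J]: the instances declared on it may use that
    proof, while [cquot J] keeps its purely algebraic structure. *)
Definition cstar_quot of cstar_ideal := cquot J.
Local Notation Q := (cstar_quot hJ).

HB.instance Definition _ := GRing.Lmodule.on Q.
HB.instance Definition _ := hasMulStar.Build Q (@cquot_mul _ _ J) (@cquot_star _ _ J).

Let qnorm (q : Q) : R[i] := (cquot_norm (q : cquot J))%:C.

Let qnormD x y : qnorm (x + y) <= qnorm x + qnorm y.
Proof. by rewrite /qnorm -rmorphD lecR; exact: cquot_normD. Qed.

Let qnormZ (a : R[i]) x : qnorm (a *: x) = `|a| * qnorm x.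
Proof.
by rewrite /qnorm [cquot_norm _]cquot_normZ rmorphM/=; congr (_ * _).
Qed.

Let qnorm0 x : qnorm x = 0 -> x = 0.
Proof. by move=> /complexI/cquot_norm_eq0. Qed.

HB.instance Definition _ := Lmodule_isNormed.Build R[i] Q qnormD qnormZ qnorm0.

Let pi (x : A) : Q := \pi_(cquot J) x.

Let rnorm_quotE (q : Q) : rnorm q = cquot_norm (q : cquot J). Proof. by []. Qed.

Let q_complete (F : set_system Q) : ProperFilter F -> cauchy F -> cvg F.
Proof.
apply: fast_complete => u fu.
have lift n : {z : A | pi z = u n.+1 - u n & rnorm z < geo n + geo n}.
  apply: cid2.
  have [z zE ze] := cquot_norm_lift (u n.+1 - u n : cquot J) (@geo_gt0 R n).
  exists z => //; apply: lt_le_trans ze _; rewrite lerD2r; exact: fu.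
pose z n := s2val (lift n).
(* The sum stops at [z n], so [y n] lies over [u n.+1]. With this shift the step from [y n] to
   [y n.+1] is [z n.+1], of norm below 2 * 2^-(n+1) = 2^-n, which makes [y] fast. *)
pose y n := repr (u 0) + \sum_(i < n.+1) z i.
have yS n : y n.+1 = y n + z n.+1 by rewrite /y big_ord_recr/= addrA.
have piy n : pi (y n) = u n.+1.
  have piD a b : pi (a + b) = pi a + pi b by exact: cquot_piD.
  elim: n => [|n IH].
    rewrite /y big_ord_recl big_ord0 addr0 piD {1}/pi reprK.
    by rewrite [pi _](s2valP (lift 0)) addrC subrK.
  by rewrite yS piD IH [pi (z _)](s2valP (lift n.+1)) addrC subrK.
have [|l yl _] := @fast_cvg _ _ y.
  move=> n; rewrite yS addrAC subrr add0r.
  by rewrite geoS; exact/ltW/(s2valP' (lift n.+1)).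
exists (pi l); apply/cvg_rnormP => e e0.
have [N NP] := (cvg_rnormP _ _).1 yl e e0.
exists N.+1 => -[|n]//; rewrite ltnS => /NP; apply: le_lt_trans.
rewrite -piy rnorm_quotE.
have -> : pi l - pi (y n) = pi (l - y n) by rewrite [RHS]cquot_piB.
exact: cquot_norm_pi.
Qed.

HB.instance Definition _ := Uniform_isComplete.Build Q q_complete.

Let pi_star_hom : star_hom (pi : A -> Q).
Proof. by have [*] := cquot_pi_star_hom (cstar_idealV hJ). Qed.
Let piM x y : amul (pi x) (pi y) = pi (amul x y).
Proof. by rewrite (star_homM pi_star_hom). Qed.
Let piV x : astar (pi x) = pi (astar x).
Proof. by rewrite (star_homV pi_star_hom). Qed.
Let piD x y : pi x + pi y = pi (x + y).
Proof. by rewrite (star_homD pi_star_hom). Qed.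
Let piZ a x : a *: pi x = pi (a *: x).
Proof. by rewrite (star_homZ pi_star_hom). Qed.
Let piE := (piM, piV, piD, piZ).
Let piP (q : Q) : exists x, q = pi x.
Proof. by exists (repr (q : cquot J)); rewrite /pi reprK. Qed.

Let qmulA (x y z : Q) : amul x (amul y z) = amul (amul x y) z.
Proof.
by have [[[a ->] [b ->]] [c ->]] := (piP x, piP y, piP z); rewrite !piE amulA.
Qed.
Let qmulDl (x y z : Q) : amul (x + y) z = amul x z + amul y z.
Proof.
by have [[[a ->] [b ->]] [c ->]] := (piP x, piP y, piP z); rewrite !piE amulDl.
Qed.
Let qmulDr (x y z : Q) : amul x (y + z) = amul x y + amul x z.
Proof.
by have [[[a ->] [b ->]] [c ->]] := (piP x, piP y, piP z); rewrite !piE amulDr.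
Qed.
Let qmulZl (k : R[i]) (x y : Q) : amul (k *: x) y = k *: amul x y.
Proof. by have [[a ->] [b ->]] := (piP x, piP y); rewrite piZ !piM piZ amulZl. Qed.
Let qmulZr (k : R[i]) (x y : Q) : amul x (k *: y) = k *: amul x y.
Proof. by have [[a ->] [b ->]] := (piP x, piP y); rewrite piZ !piM piZ amulZr. Qed.
Let qstarK (x : Q) : astar (astar x) = x.
Proof. by have [a ->] := piP x; rewrite !piE astarK. Qed.
Let qstarD (x y : Q) : astar (x + y) = astar x + astar y.
Proof. by have [[a ->] [b ->]] := (piP x, piP y); rewrite !piE astarD. Qed.
Let qstarZ (k : R[i]) (x : Q) : astar (k *: x) = conjc k *: astar x.
Proof. by have [a ->] := piP x; rewrite piZ !piV piZ astarZ. Qed.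
Let qstarM (x y : Q) : astar (amul x y) = amul (astar y) (astar x).
Proof. by have [[a ->] [b ->]] := (piP x, piP y); rewrite !piE astarM. Qed.

Let qrnormM (x y : Q) : rnorm (amul x y) <= rnorm x * rnorm y.
Proof.
(* For d <= 1, (|x| + d)(|y| + d) <= |x| |y| + d M; representatives are taken within d of the
   quotient norms. *)
apply/ler_addgt0Pr => e e0; set M := rnorm x + rnorm y + 1.
have M0 : 0 < M by have := rnorm_ge0 x; have := rnorm_ge0 y; rewrite /M; lra.
pose d := Num.min 1 (e / M).
have d0 : 0 < d by rewrite lt_min ltr01 divr_gt0.
have d1 : d <= 1 by rewrite ge_min lexx.
have dM : d * M <= e by rewrite -ler_pdivlMr// ge_min lexx orbT.
have [a ax an] := cquot_norm_lift (x : cquot J) d0.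
have [b bx bn] := cquot_norm_lift (y : cquot J) d0.
have -> : amul x y = pi (amul a b) by rewrite -piM /pi ax bx.
apply: (@le_trans _ _ (rnorm (amul a b))); first exact: cquot_norm_pi.
apply: le_trans (rnormM a b) _.
move: an bn dM; rewrite -!rnorm_quotE /M.
have := rnorm_ge0 a; have := rnorm_ge0 b; have := rnorm_ge0 x; have := rnorm_ge0 y.
nra.
Qed.

Let qnormM (x y : Q) : `|amul x y| <= `|x| * `|y|.
Proof. by rewrite -!rnormE -rmorphM lecR. Qed.

Let qnormC (x : Q) : `|amul (astar x) x| = `|x| ^+ 2.
Proof.
(* This half of the C*-identity is [cstar_idealC]. Together with submultiplicativity it makes the
   involution isometric, and the other half follows. *)
have le (z : Q) : rnorm z ^+ 2 <= rnorm (amul (astar z) z).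
  by have [a ->] := piP z; rewrite !piE; exact: cstar_idealC.
have star_le (z : Q) : rnorm z <= rnorm (astar z).
  have [->|z0] := eqVneq (rnorm z) 0; first exact: rnorm_ge0.
  have {}z0 : 0 < rnorm z by rewrite lt_def z0 rnorm_ge0.
  by rewrite -(ler_pM2r z0) -expr2; apply: le_trans (le z) (qrnormM _ _).
have starE (z : Q) : rnorm (astar z) = rnorm z.
  by apply/eqP; rewrite eq_le star_le andbT -{2}[z]qstarK star_le.
rewrite -!rnormE -rmorphXn; congr _%:C; apply/eqP; rewrite eq_le le andbT.
by apply: le_trans (qrnormM _ _) _; rewrite starE expr2.
Qed.

HB.instance Definition _ := isCstarAlgebra.Build R Q
  qmulA qmulDl qmulDr qmulZl qmulZr qstarK qstarD qstarZ qstarM qnormM qnormC.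

End CstarQuotient.

Section NullIdeal.
Variables (R : realType) (D : nat -> cstarType R) (E : subCstar (bprod D)).
Hypothesis truncE : forall k x, sub_set E x -> sub_set E (trunc k x).

(** Let [z] represent the class of x* x with almost minimal norm. From some N on, |x_n|^2 = |x_n*
    x_n| is at most |z| up to a small error, and erasing the coordinates of x below N does not
    change its class. *)
Lemma null_cstar_ideal : cstar_ideal (null_ideal E).
Proof.
split=> x; first exact: null_idealV.
apply/ler_addgt0Pr => e e0; have e20 : 0 < e / 2%:R by lra.
have [z zE ze] := cquot_norm_lift (\pi_(cquot (null_ideal E)) (amul (astar x) x)) e20.
set m := cquot_norm (_ (amul _ _)) in ze *.
have /(null_idealP truncE)/(_ _ e20)[N NP] := (cquot_piP _ _ _).1 zE.
have m0 : 0 <= m by exact: cquot_norm_ge0.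
pose y : sub_alg E := x - mksub (truncE N (sub_algP x)).
have -> : \pi_(cquot (null_ideal E)) x = \pi_(cquot (null_ideal E)) y.
  apply/cquot_piP; rewrite opprB addrC subrK.
  apply/(null_idealP truncE) => d d0; exists N => n Nn.
  by rewrite /ev bcoord_trunc ltnNge Nn rnorm0.
have ym : rnorm y ^+ 2 <= m + e.
  rewrite -[leRHS]sqr_sqrtr; last by lra.
  rewrite lerXn2r ?nnegrE ?rnorm_ge0 ?sqrtr_ge0//.
  apply: rnorm_bprod_le => n; rewrite -[leLHS]ger0_norm ?rnorm_ge0// -sqrtr_sqr.
  rewrite ler_wsqrtr// (star_homB (bcoord_star_hom n)) bcoord_trunc.
  case: ltnP => [_|/NP]; first by rewrite subrr rnorm0; lra.
  rewrite subr0 -rnormCstar (star_homB (ev_star_hom n)).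
  rewrite (star_homM (ev_star_hom n)) (star_homV (ev_star_hom n)) => xz.
  have := rnorm_le_dist (amul (astar (ev n x)) (ev n x)) (ev n z).
  rewrite rnormBC; have := rnorm_ev n z; rewrite /ev; move: xz ze; rewrite /ev; lra.
apply: le_trans ym; rewrite lerXn2r ?nnegrE ?rnorm_ge0 ?cquot_norm_ge0//.
exact: cquot_norm_pi.
Qed.

End NullIdeal.

(** * Composites of connecting morphisms *)

Section Push.
Variables (R : realType) (C : nat -> cstarType R) (phi : forall n, C n -> C n.+1).
Hypothesis hphi : forall n, star_hom (@phi n).

(* The connecting morphism C k -> C n, and the zero map when n < k. *)
Fixpoint push k (x : C k) n : C n :=
  match n with
  | 0%N => dfwith (fun i => 0 : C i) k x 0%N
  | m.+1 => dfwith (dfwith (fun i => 0 : C i) m.+1 (phi (@push k x m))) k x m.+1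
  end.

Lemma push_id k (x : C k) : push x k = x.
Proof. by case: k x => [|k] x; rewrite /= dfwithin. Qed.

Lemma pushS k (x : C k) n : (k <= n)%N -> push x n.+1 = phi (push x n).
Proof. by move=> kn /=; rewrite dfwithout ?dfwithin// ltn_eqF. Qed.

Lemma push_lt k (x : C k) n : (n < k)%N -> push x n = 0.
Proof.
elim: n => [|n IH] nk /=; first by rewrite dfwithout// gtn_eqF.
rewrite dfwithout ?gtn_eqF// dfwithin IH ?(star_hom0 (@hphi n))//.
exact: ltnW.
Qed.

Lemma star_hom_zero (A B : cstarType R) : star_hom (fun _ : A => 0 : B).
Proof.
split=> [a x y|x y|x].
- by rewrite scaler0 addr0.
- by rewrite amul0l.
- by rewrite astar0.
Qed.

Lemma push_star_hom k n : star_hom (fun x : C k => push x n).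
Proof.
have ext (A B : cstarType R) (f g : A -> B) : star_hom g -> f =1 g -> star_hom f.
  by move=> hg fg; rewrite (funext fg).
have [nk|kn] := ltnP n k.
  by apply: ext (@star_hom_zero _ _) _ => x; exact: push_lt.
move: n kn; apply: leq_ind => [|n kn IH].
  by apply: ext (@star_hom_id _ _) _ => x; exact: push_id.
by apply: ext (star_hom_comp (hphi n) IH) _ => x; exact: pushS.
Qed.

Lemma push_phi k (x : C k) n : (k < n)%N -> push (phi x) n = push x n.
Proof.
move: n; apply: leq_ind => [|n kn IH]; first by rewrite push_id pushS// push_id.
by rewrite !pushS ?IH// ltnW.
Qed.

Lemma cocone_push (B : cstarType R) (nu : forall n, C n -> B) k (x : C k) n :
  cocone phi nu -> (k <= n)%N -> nu n (push x n) = nu k x.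
Proof.
move=> [_ nuS]; move: n; apply: leq_ind => [|n kn IH]; first by rewrite push_id.
by rewrite pushS// nuS.
Qed.

Lemma rnorm_push k (x : C k) n : rnorm (push x n) <= rnorm x.
Proof. exact: star_hom_contract (push_star_hom k n). Qed.

End Push.

(** * Sequences whose images in a fixed algebra converge, and their limits *)

Section SequenceLimit.
Variables (R : realType) (D : nat -> cstarType R) (L : cstarType R).
Variable m : forall n, D n -> L.
Arguments m : clear implicits.
Hypothesis hm : forall n, star_hom (m n).

Definition convergent : set (bprod D) :=
  [set x | exists l : L, (fun n => m n (bcoord n x)) @ \oo --> l].

Lemma convergent_star_subset : star_subset convergent.
Proof.
split=> [|x y [l xl] [k yk]|a x [l xl]|x y [l xl] [k yk]|x [l xl]].
- exists 0; under eq_fun do rewrite (star_hom0 (bcoord_star_hom _)) (star_hom0 (hm _)).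
  exact: cvg_cst.
- exists (l + k); under eq_fun do
    rewrite (star_homD (bcoord_star_hom _)) (star_homD (hm _)).
  exact: cvgD.
- exists (a *: l); under eq_fun do
    rewrite (star_homZ (bcoord_star_hom _)) (star_homZ (hm _)).
  exact: cvg_scale.
- exists (amul l k); under eq_fun do
    rewrite (star_homM (bcoord_star_hom _)) (star_homM (hm _)).
  exact: cvg_amul.
- exists (astar l); under eq_fun do
    rewrite (star_homV (bcoord_star_hom _)) (star_homV (hm _)).
  exact: cvg_astar.
Qed.

Lemma convergent_closed : closed convergent.
Proof.
apply: closed_rnormP => x H; apply: cauchy_seq_cvg => e e0.
have e40 : 0 < e / 4%:R by lra.
have [y [l /cvg_rnormP yl] xy] := H _ e40; have [N NP] := yl _ e40.
(* The [m n] are contractive, so the approximation of x by y is uniform in n. *)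
have mxy n : rnorm (m n (bcoord n x) - m n (bcoord n y)) < e / 4%:R.
  rewrite -(star_homB (hm n)) -(star_homB (bcoord_star_hom n)).
  apply: le_lt_trans xy; apply: le_trans (star_hom_contract _ (hm n)) _.
  exact: rnorm_bcoord.
exists N => n Nn; have := mxy n; have := mxy N; have := NP n Nn; have := NP N (leqnn N).
rewrite (rnormBC (m N _)).
have := rnorm_dist (m n (bcoord n y)) (m n (bcoord n x)) (m N (bcoord N x)).
have := rnorm_dist l (m n (bcoord n y)) (m N (bcoord N x)).
have := rnorm_dist (m N (bcoord N y)) l (m N (bcoord N x)).
rewrite (rnormBC (m n _) l); lra.
Qed.

Variables (E : subCstar (bprod D)) (Econv : sub_set E `<=` convergent).

Definition seq_lim (x : sub_alg E) : L := sval (cid (Econv (sub_algP x))).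

Lemma seq_limP x : (fun n => m n (ev n x)) @ \oo --> seq_lim x.
Proof. by rewrite /seq_lim; case: cid. Qed.

Lemma seq_lim_star_hom : star_hom seq_lim.
Proof.
split=> [a x y|x y|x]; apply: seq_cvg_unique (@seq_limP _) _.
- under eq_fun do rewrite (star_hom_linear (ev_star_hom _)) (star_hom_linear (hm _)).
  by apply: cvgD (@seq_limP _); apply: cvg_scale; exact: seq_limP.
- under eq_fun do rewrite (star_homM (ev_star_hom _)) (star_homM (hm _)).
  by apply: cvg_amul; exact: seq_limP.
- under eq_fun do rewrite (star_homV (ev_star_hom _)) (star_homV (hm _)).
  by apply: cvg_astar; exact: seq_limP.
Qed.

Hypothesis truncE : forall k x, sub_set E x -> sub_set E (trunc k x).

Lemma seq_lim_null x : ideal_set (null_ideal E) x -> seq_lim x = 0.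
Proof.
move=> /(null_idealP truncE) x0; apply: seq_cvg_unique (@seq_limP x) _.
apply/cvg_rnormP => e /x0[N NP]; exists N => n /NP; rewrite sub0r rnormN.
exact/le_lt_trans/star_hom_contract.
Qed.

End SequenceLimit.
Arguments seq_limP {R D L m E} Econv x.

(** * Approximate lifts to approximating subalgebras *)

Section LiftToSubalgebras.
Variables (R : realType) (A : cstarType R) (B : nat -> subCstar A).
Hypothesis B_dense : forall (a : A) (e : R), 0 < e ->
  exists N, forall n, (N <= n)%N -> exists2 y, sub_set (B n) y & rnorm (a - y) < e.

Let D n : cstarType R := sub_alg (B n).
Let inc n : D n -> A := val.
Let hinc n : star_hom (@inc n) := val_star_hom (B n).

Let E : subCstar (bprod D) :=
  let h := convergent_star_subset hinc in
  SubCstar (convergent_closed hinc) (star_subset0 h) (star_subsetD h)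
    (star_subsetZ h) (star_subsetM h) (star_subsetV h).

Let Econv : sub_set E `<=` convergent inc. Proof. by []. Qed.

Let truncE k x : sub_set E x -> sub_set E (trunc k x).
Proof.
move=> _; exists 0; apply: (@cvg_eventually _ _ (fun=> 0) _ _ k); last exact: cvg_cst.
by move=> n kn; rewrite bcoord_trunc ltnNge kn (star_hom0 (@hinc n)).
Qed.

(** The distance from a to B n need not be attained; an error of 2^-n is allowed, so that one
    sequence serves all tolerances at once. *)
Let nearest (a : A) n : {y : D n | forall z : D n,
  rnorm (a - inc y) <= rnorm (a - inc z) + geo n}.
Proof.
apply: cid; pose S := range (fun z : D n => rnorm (a - inc z)).
have S0 : has_inf S.
  split; first by exists (rnorm (a - inc (0 : D n))), 0.
  by exists 0 => _ [z _ <-]; exact: rnorm_ge0.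
have [_ [y _ <-] ye] := inf_adherent (@geo_gt0 R n) S0.
exists y => z; apply: le_trans (ltW ye) _; rewrite lerD2r.
by apply: ge_inf; [exact: S0.2|exists z].
Qed.

Let near_seq a : {x : sub_alg E | seq_lim Econv x = a}.
Proof.
pose x : dprod D := fun n => sval (nearest a n).
have xP n (z : D n) : rnorm (a - inc (x n)) <= rnorm (a - inc z) + geo n.
  exact: (svalP (nearest a n) z).
(* Comparison with the competitor 0 keeps the sequence bounded, as membership in [bprod] demands. *)
have xM n : rnorm (x n) <= rnorm a + (rnorm a + geo 0).
  have := xP n 0; rewrite (star_hom0 (@hinc n)) subr0.
  have := rnorm_le_dist (inc (x n)) a; rewrite rnormBC -rnorm_val.
  by have := @geo_le R _ _ (leq0n n); rewrite /inc; lra.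
have xa : (fun n => inc (bcoord n (mkbprod xM))) @ \oo --> a.
  apply/cvg_rnormP => e e0; have e20 : 0 < e / 2%:R by lra.
  have [M MP] := B_dense a e20; have [N NP] := geo_lt e20.
  exists (maxn M N) => n; rewrite geq_max => /andP[/MP[y By ay] /NP ne].
  have := xP n (mksub By); rewrite {2}/inc/=; move: ay ne; rewrite /bcoord/=; lra.
have Ex : sub_set E (mkbprod xM) by exists a.
by exists (mksub Ex); apply: seq_cvg_unique (seq_limP _ _) xa.
Qed.

(** The limit map is onto A by [near_seq] and has the null sequences as its kernel, so f followed by
    any choice of preimages becomes a morphism modulo [null_ideal E]. *)
Lemma lift_to_subalgebras (C : cstarType R) (f : C -> A) (F : set C) (e : R) :
  weakly_semiprojective C -> star_hom f -> finite_set F -> 0 < e ->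
  exists N, forall n, (N <= n)%N -> exists2 psi : C -> sub_alg (B n), star_hom psi &
    forall x, F x -> rnorm (val (psi x) - f x) < e.
Proof.
move=> Cw hf finF e0; have e20 : 0 < e / 2%:R by lra.
pose s c := sval (near_seq (f c)).
have sE c : seq_lim Econv (s c) = f c by exact: svalP (near_seq (f c)).
pose hlim := seq_lim_star_hom hinc Econv.
(* In a subalgebra the norm is that of A, so a sequence whose images tend to 0 is itself null. *)
have pi_eq x y : seq_lim Econv x = seq_lim Econv y ->
    \pi_(cquot (null_ideal E)) x = \pi_(cquot (null_ideal E)) y.
  move=> xy; apply/cquot_piP/(null_idealP truncE) => d d0.
  have [N NP] := (cvg_rnormP _ _).1 (seq_limP Econv (x - y)) d d0.
  by exists N => n /NP; rewrite (star_homB hlim) xy subrr sub0r rnormN.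
pose sigma c : cquot (null_ideal E) := \pi_(cquot (null_ideal E)) (s c).
have hpi := cquot_pi_star_hom (null_idealV truncE).
have hsigma : star_hom sigma.
  split=> [a x y|x y|x].
  - rewrite /sigma -(star_hom_linear hpi); apply: pi_eq.
    by rewrite (star_hom_linear hlim) !sE (star_hom_linear hf).
  - rewrite /sigma -(star_homM hpi); apply: pi_eq.
    by rewrite (star_homM hlim) !sE (star_homM hf).
  - rewrite /sigma -(star_homV hpi); apply: pi_eq.
    by rewrite (star_homV hlim) !sE (star_homV hf).
have [M MP] := weakly_semiprojective_lift truncE Cw hsigma (fun=> erefl) finF e20.
have [|N NP] := @finite_eventually _ F
    (fun x n => rnorm (f x - inc (ev n (s x))) < e / 2%:R) finF.
  by move=> x _; have /cvg_rnormP/(_ _ e20) := seq_limP Econv (s x); rewrite sE.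
exists (maxn M N) => n; rewrite geq_max => /andP[/MP[psi hpsi psiE] /NP fE].
exists psi => // x Fx; have := psiE x Fx; have := fE x Fx; rewrite rnormBC => h1.
rewrite -rnorm_val [val _](star_homB (@hinc n)) => h2.
have := rnorm_dist (val (ev n (s x))) (val (psi x)) (f x); move: h1 h2; rewrite /inc; lra.
Qed.

End LiftToSubalgebras.

(** * Approximate lifts to the stages of an inductive limit *)

Section LiftToStages.
Variables (R : realType) (C : nat -> cstarType R) (phi : forall n, C n -> C n.+1).
Hypothesis hphi : forall n, star_hom (@phi n).
Variables (L : cstarType R) (mu : forall n, C n -> L).
Arguments mu : clear implicits.
Hypothesis hmu : inductive_limit phi mu.

Let hmun n : star_hom (mu n) := hmu.1.1 n.

(** Exact coherence from some index on is an algebraic condition that contains all threads; the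
    closure is taken in [E]. *)
Let coherent : set (bprod C) :=
  [set x : bprod C | exists k, forall n, (k <= n)%N -> bcoord n.+1 x = phi (bcoord n x)].

Let coherent_star_subset : star_subset coherent.
Proof.
split=> [|x y [k xk] [l yl]|a x [k xk]|x y [k xk] [l yl]|x [k xk]].
- by exists 0%N => n _; rewrite (star_hom0 (bcoord_star_hom n)) (star_hom0 (@hphi n)).
- exists (maxn k l) => n; rewrite geq_max => /andP[/xk xn /yl yn].
  rewrite (star_homD (bcoord_star_hom n)) (star_homD (@hphi n)) -xn -yn.
  exact: (star_homD (bcoord_star_hom n.+1)).
- exists k => n /xk xn; rewrite (star_homZ (bcoord_star_hom n)) (star_homZ (@hphi n)) -xn.
  exact: (star_homZ (bcoord_star_hom n.+1)).
- exists (maxn k l) => n; rewrite geq_max => /andP[/xk xn /yl yn].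
  rewrite (star_homM (bcoord_star_hom n)) (star_homM (@hphi n)) -xn -yn.
  exact: (star_homM (bcoord_star_hom n.+1)).
- exists k => n /xk xn; rewrite (star_homV (bcoord_star_hom n)) (star_homV (@hphi n)) -xn.
  exact: (star_homV (bcoord_star_hom n.+1)).
Qed.

Let E := sub_closure coherent_star_subset.

Let truncE k x : sub_set E x -> sub_set E (trunc k x).
Proof.
move=> /closure_rnormP Ex; apply/closure_rnormP => e /Ex[y _ xy].
exists (trunc k y).
  exists k => n kn; rewrite !bcoord_trunc !ltnNge kn (leq_trans kn)//=.
  by rewrite (star_hom0 (@hphi n)).
apply: le_lt_trans xy; rewrite -(star_homB (trunc_star_hom _ k)).
apply: rnorm_bprod_le => n; rewrite bcoord_trunc; case: ifP => _.
  exact: rnorm_bcoord.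
by rewrite rnorm0 rnorm_ge0.
Qed.

Let Econv : sub_set E `<=` convergent mu.
Proof.
have cC : coherent `<=` convergent mu.
  move=> x [k xk]; exists (mu k (bcoord k x)).
  apply: (@cvg_eventually _ _ (fun=> mu k (bcoord k x)) _ _ k); last exact: cvg_cst.
  by apply: leq_ind => // n kn ->; rewrite xk// hmu.1.2.
move=> x Ex; apply: (convergent_closed hmun).
exact: closure_subset cC _ Ex.
Qed.

Let thread k (x : C k) : bprod C := mkbprod (rnorm_push hphi x).

Let threadE k (x : C k) : sub_set E (thread x).
Proof. by apply: subset_closure; exists k => n kn; exact: pushS. Qed.

Let thr k (x : C k) : sub_alg E := mksub (@threadE k x).

Let ev_thr k (x : C k) n : ev n (thr x) = push phi x n. Proof. by []. Qed.

Let thr_star_hom k : star_hom (@thr k).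
Proof.
have eqE (x y : sub_alg E) : (forall n, ev n x = ev n y) -> x = y.
  by move=> xy; apply: val_inj; apply: bprod_eq.
split=> [a x y|x y|x]; apply: eqE => n.
- rewrite (star_hom_linear (ev_star_hom n)) !ev_thr.
  by rewrite (star_hom_linear (push_star_hom hphi k n)).
- by rewrite (star_homM (ev_star_hom n)) !ev_thr (star_homM (push_star_hom hphi k n)).
- by rewrite (star_homV (ev_star_hom n)) !ev_thr (star_homV (push_star_hom hphi k n)).
Qed.

Let Q : cstarType R := cstar_quot (null_cstar_ideal truncE).
Let pi (x : sub_alg E) : Q := \pi_(cquot (null_ideal E)) x.
Let nu k (x : C k) : Q := pi (thr x).

Let nu_cocone : cocone phi nu.
Proof.
split=> [n|n x].
  exact: star_hom_comp (cquot_pi_star_hom (null_idealV truncE)) (thr_star_hom n).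
(* The threads of x and of [phi x] differ only at coordinate n, where the latter is still 0. *)
apply/cquot_piP/(null_idealP truncE) => e e0; exists n.+1 => m nm.
by rewrite (star_homB (ev_star_hom m)) !ev_thr push_phi// subrr rnorm0.
Qed.

Let lim_null : forall x, ideal_set (null_ideal E) x -> seq_lim Econv x = 0.
Proof. by move=> x; exact: seq_lim_null. Qed.

(** The classes of threads form a cocone, so the universal property maps L to [Q] by some g, and f
    is lifted through g. The bound on |psi x| holds because g is contractive: the class g (f x) has
    norm at most |f x|. *)
Lemma lift_to_stages (P : cstarType R) (f : P -> L) (F : set P) (e : R) :
  weakly_semiprojective P -> star_hom f -> finite_set F -> 0 < e ->
  exists N, forall n, (N <= n)%N -> exists2 psi : P -> C n, star_hom psi &
    forall x, F x -> rnorm (mu n (psi x) - f x) < e /\ rnorm (psi x) < rnorm (f x) + e.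
Proof.
move=> Pw hf finF e0; have e40 : 0 < e / 4%:R by lra.
have [g [[hg gmu] _]] := hmu.2 Q nu nu_cocone.
pose hlim := seq_lim_star_hom hmun Econv.
pose back : Q -> L := cquot_lift (seq_lim Econv).
have hback : star_hom back by exact: (cquot_lift_star_hom hlim lim_null).
(* Both sides are endomorphisms of L that fix every [mu n x], so the uniqueness clause identifies
   them. Hence any sequence representing g (f c) has limit f c. *)
have backg : back \o g = id.
  have [h [_ hU]] := hmu.2 L mu hmu.1.
  rewrite -(hU (back \o g)); last first.
    split=> [|n x]; first exact: star_hom_comp hback hg.
    rewrite /= gmu /back /nu /pi (cquot_liftE hlim lim_null).
    apply: seq_cvg_unique (seq_limP _ _) _.
    apply: (@cvg_eventually _ _ (fun=> mu n x) _ _ n); last exact: cvg_cst.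
    by move=> m nm; rewrite ev_thr (cocone_push _ hmu.1).
  by apply: hU; split=> //; exact: star_hom_id.
pose sigma : P -> cquot (null_ideal E) := g \o f.
have hsigma : star_hom sigma by exact: star_hom_comp hg hf.
pose s c : sub_alg E := repr (sigma c).
have sE c : \pi_(cquot (null_ideal E)) (s c) = sigma c by exact: reprK.
have slim c : seq_lim Econv (s c) = f c.
  by rewrite -[f c]/(id (f c)) -backg.
have [M MP] := weakly_semiprojective_lift truncE Pw hsigma sE finF e40.
have [|N NP] := @finite_eventually _ F
    (fun x n => rnorm (f x - mu n (ev n (s x))) < e / 4%:R /\
                rnorm (ev n (s x)) < rnorm (f x) + e / 2%:R) finF.
  move=> x _; have /cvg_rnormP/(_ _ e40)[N1 N1P] := seq_limP Econv (s x).
  (* The chosen representative [s x] may be large in its first coordinates; it agrees up to a null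
     sequence with [z], whose norm is almost that of the class. *)
  have [z zE ze] := cquot_norm_lift (sigma x) e40.
  have /(null_idealP truncE)/(_ _ e40)[N2 N2P] : ideal_set (null_ideal E) (s x - z).
    by apply/cquot_piP; rewrite sE zE.
  have sf : cquot_norm (sigma x) <= rnorm (f x) := star_hom_contract (f x) hg.
  exists (maxn N1 N2) => n; rewrite geq_max => /andP[/N1P h1 /N2P h2].
  split; first by rewrite -slim.
  move: h2; rewrite (star_homB (ev_star_hom n)).
  have := rnorm_le_dist (ev n (s x)) (ev n z); have := rnorm_ev n z; lra.
exists (maxn M N) => n; rewrite geq_max => /andP[/MP[psi hpsi psiE] /NP fE].
exists psi => // x Fx; have := psiE x Fx; have [h1 h2] := fE x Fx => h3; split.
  have := star_hom_contract (psi x - ev n (s x)) (hmun n).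
  rewrite (star_homB (hmun n)); rewrite rnormBC in h1.
  have := rnorm_dist (mu n (ev n (s x))) (mu n (psi x)) (f x); lra.
have := rnorm_le_dist (psi x) (ev n (s x)); lra.
Qed.

End LiftToStages.

(** * Recognising inductive limits *)

Section InductiveLimits.
Variables (R : realType) (C : nat -> cstarType R) (phi : forall n, C n -> C n.+1).
Hypothesis hphi : forall n, star_hom (@phi n).

Section Density.
Variables (L : cstarType R) (mu : forall n, C n -> L).
Arguments mu : clear implicits.

Section Cocone.
Hypothesis hmu : cocone phi mu.

Lemma cocone_common m n (x : C m) (y : C n) : exists k (u v : C k),
  forall (B : cstarType R) (nu : forall n, C n -> B), cocone phi nu ->
  nu m x = nu k u /\ nu n y = nu k v.
Proof.
exists (maxn m n), (push phi x _), (push phi y _) => B nu hnu.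
by rewrite !(cocone_push _ hnu) ?leq_maxl ?leq_maxr.
Qed.

Lemma cocone_union_star_subset : star_subset [set a | exists n x, a = mu n x].
Proof.
split=> [|_ _ [m [x ->]] [n [y ->]]|a _ [n [x ->]]|_ _ [m [x ->]] [n [y ->]]|_ [n [x ->]]].
- by exists 0%N, 0; rewrite (star_hom0 (hmu.1 0%N)).
- have [k [u [v /(_ _ _ hmu)[-> ->]]]] := cocone_common x y.
  by exists k, (u + v); rewrite (star_homD (hmu.1 k)).
- by exists n, (a *: x); rewrite (star_homZ (hmu.1 n)).
- have [k [u [v /(_ _ _ hmu)[-> ->]]]] := cocone_common x y.
  by exists k, (amul u v); rewrite (star_homM (hmu.1 k)).
- by exists n, (astar x); rewrite (star_homV (hmu.1 n)).
Qed.

End Cocone.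

(* The universal property retracts L onto the closure of the union. *)
Lemma inductive_limit_dense (a : L) (e : R) : inductive_limit phi mu -> 0 < e ->
  exists n (x : C n), rnorm (a - mu n x) < e.
Proof.
move=> [hmu hU] e0; pose S := sub_closure (cocone_union_star_subset hmu).
have muS n x : sub_set S (mu n x) by apply: subset_closure; exists n, x.
pose nu n (x : C n) : sub_alg S := mksub (@muS n x).
have hnu : cocone phi nu.
  split=> [n|n x]; last by apply: val_inj; exact: hmu.2.
  have [h1 h2 h3] := hmu.1 n.
  by split=> [k x y|x y|x]; apply: val_inj; [exact: h1|exact: h2|exact: h3].
have [g [[hg gmu] _]] := hU _ _ hnu; have [h [_ hu]] := hU _ _ hmu.
have gid : val \o g = id.
  rewrite -(hu (val \o g)); last first.
    split=> [|n x]; last by rewrite /= gmu.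
    exact: star_hom_comp (val_star_hom S) hg.
  by apply: hu; split=> //; exact: star_hom_id.
have /closure_rnormP/(_ e e0)[_ [n [x ->]]] : sub_set S a.
  by rewrite -[a](congr1 (@^~ a) gid); exact: sub_algP.
by exists n, x.
Qed.

Lemma inductive_limit_iso (A : cstarType R) (f : L -> A) :
  inductive_limit phi mu -> star_hom f -> bijective f ->
  inductive_limit phi (fun n => f \o mu n).
Proof.
move=> [hmu hU] hf [f' fK f'K]; have hf' := star_hom_cancel hf fK f'K.
split=> [|B nu hnu].
  split=> [n|n x]; first exact: star_hom_comp hf (hmu.1 n).
  by rewrite /= hmu.2.
have [g [[hg gmu] gU]] := hU B nu hnu; exists (g \o f'); split.
  split=> [|n x]; first exact: star_hom_comp hg hf'.
  by rewrite /= fK gmu.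
move=> h [hh hmuE]; rewrite (gU (h \o f)).
  by apply: funext => x; rewrite /= f'K.
by split=> //; exact: star_hom_comp hh hf.
Qed.

End Density.

Section Criterion.
Variables (L : cstarType R) (mu : forall n, C n -> L).
Arguments mu : clear implicits.
Hypotheses (hmu : cocone phi mu)
  (mu_norm : forall n (x : C n) (e : R), 0 < e ->
    exists2 m, (n <= m)%N & rnorm (push phi x m) <= rnorm (mu n x) + e)
  (mu_dense : forall (a : L) (e : R), 0 < e ->
    exists n (x : C n), rnorm (a - mu n x) < e).

Section UniversalProperty.
Variables (B : cstarType R) (nu : forall n, C n -> B).
Arguments nu : clear implicits.
Hypothesis hnu : cocone phi nu.

(** [nu n x] equals [nu m (push phi x m)], and [nu m] is contractive; [mu_norm] picks m. *)
Let nu_le n (x : C n) : rnorm (nu n x) <= rnorm (mu n x).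
Proof.
apply/ler_addgt0Pr => e e0; have [m nm] := mu_norm x e0; apply: le_trans.
by rewrite -(cocone_push x hnu nm); exact: star_hom_contract (hnu.1 m).
Qed.

(** The graph of the wanted map on the union of the images. A relation avoids choosing a stage and a
    preimage for each point; [Gdist] shows that it is single-valued and contractive. *)
Let G (a : L) (b : B) := exists n (x : C n), a = mu n x /\ b = nu n x.

Let Gdist a b a' b' : G a b -> G a' b' -> rnorm (b - b') <= rnorm (a - a').
Proof.
move=> [n [x [-> ->]]] [m [y [-> ->]]]; have [k [u [v uv]]] := cocone_common x y.
have [[-> ->] [-> ->]] := (uv _ _ hmu, uv _ _ hnu).
rewrite -(star_homB (hmu.1 k)) -(star_homB (hnu.1 k)); exact: nu_le.
Qed.

Let G_linear (c : R[i]) a b a' b' : G a b -> G a' b' -> G (c *: a + a') (c *: b + b').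
Proof.
move=> [n [x [-> ->]]] [m [y [-> ->]]]; have [k [u [v uv]]] := cocone_common x y.
have [[-> ->] [-> ->]] := (uv _ _ hmu, uv _ _ hnu).
exists k, (c *: u + v).
by rewrite (star_hom_linear (hmu.1 k)) (star_hom_linear (hnu.1 k)).
Qed.

Let G_mul a b a' b' : G a b -> G a' b' -> G (amul a a') (amul b b').
Proof.
move=> [n [x [-> ->]]] [m [y [-> ->]]]; have [k [u [v uv]]] := cocone_common x y.
have [[-> ->] [-> ->]] := (uv _ _ hmu, uv _ _ hnu).
by exists k, (amul u v); rewrite (star_homM (hmu.1 k)) (star_homM (hnu.1 k)).
Qed.

Let G_star a b : G a b -> G (astar a) (astar b).
Proof.
move=> [n [x [-> ->]]].
by exists n, (astar x); rewrite (star_homV (hmu.1 n)) (star_homV (hnu.1 n)).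
Qed.

Let extend (a : L) : {b : B | exists u v,
  [/\ forall k, G (u k) (v k), u @ \oo --> a & v @ \oo --> b]}.
Proof.
apply: cid.
have /choice[u uP] : forall k, exists p : L * B, G p.1 p.2 /\ rnorm (a - p.1) < geo k.
  move=> k; have [n [x ax]] := mu_dense a (@geo_gt0 R k).
  by exists (mu n x, nu n x); split=> //; exists n, x.
have ua : (fun k => (u k).1) @ \oo --> a.
  apply/cvg_rnormP => e /(@geo_lt R)[N NP]; exists N => n /NP.
  exact: lt_trans (uP n).2.
have [b ub] : exists b : B, (fun k => (u k).2) @ \oo --> b.
  apply: cauchy_seq_cvg => e e0; have e20 : 0 < e / 2%:R by lra.
  have [N NP] := (cvg_rnormP _ _).1 ua _ e20; exists N => n Nn.
  have := Gdist (uP n).1 (uP N).1; have := NP n Nn; have := NP N (leqnn N).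
  have := rnorm_dist a (u n).1 (u N).1; rewrite (rnormBC _ a); lra.
by exists b, (fun k => (u k).1), (fun k => (u k).2); split=> // k; exact: (uP k).1.
Qed.

Let g a := sval (extend a).

Let gP a : exists u v, [/\ forall k, G (u k) (v k), u @ \oo --> a & v @ \oo --> g a].
Proof. exact: svalP (extend a). Qed.

(** The value of g may be computed along any approximating sequence, in particular along sums and
    products of given ones; this makes g a morphism. *)
Let g_cvg u v a : (forall k, G (u k) (v k)) -> u @ \oo --> a -> v @ \oo --> g a.
Proof.
move=> uv ua; have [u' [v' [uv' ua' va']]] := gP a.
apply/cvg_rnormP => e e0; have e30 : 0 < e / 3%:R by lra.
have [N1 P1] := (cvg_rnormP _ _).1 ua _ e30.
have [N2 P2] := (cvg_rnormP _ _).1 ua' _ e30.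
have [N3 P3] := (cvg_rnormP _ _).1 va' _ e30.
exists N1 => n /P1 h1; pose k := maxn N2 N3.
have := P2 k (leq_maxl _ _); have := P3 k (leq_maxr _ _).
have := Gdist (uv' k) (uv n); have := rnorm_dist (v' k) (g a) (v n).
have := rnorm_dist a (u' k) (u n); rewrite (rnormBC (u' k) a); lra.
Qed.

Lemma criterion_extension :
  exists! h : L -> B, star_hom h /\ forall n (x : C n), h (mu n x) = nu n x.
Proof.
have gmu n (x : C n) : g (mu n x) = nu n x.
  apply: (@seq_cvg_unique _ _ (fun=> nu n x)); last exact: cvg_cst.
  by apply: (@g_cvg (fun=> mu n x)) => [k|]; [exists n, x|exact: cvg_cst].
exists g; split.
  split=> //; split=> [c x y|x y|x].
  - have [[u [v [uv ux vx]]] [u' [v' [uv' uy vy]]]] := (gP x, gP y).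
    have h : (fun k => c *: v k + v' k) @ \oo --> c *: g x + g y.
      by apply: cvgD vy; exact: cvg_scale.
    apply: seq_cvg_unique h; apply: (@g_cvg (fun k => c *: u k + u' k)) => [k|].
      exact: G_linear.
    by apply: cvgD uy; exact: cvg_scale.
  - have [[u [v [uv ux vx]]] [u' [v' [uv' uy vy]]]] := (gP x, gP y).
    apply: (seq_cvg_unique _ (cvg_amul vx vy)).
    by apply: g_cvg (cvg_amul ux uy) => k; exact: G_mul.
  - have [u [v [uv ux vx]]] := gP x; apply: (seq_cvg_unique _ (cvg_astar vx)).
    by apply: g_cvg (cvg_astar ux) => k; exact: G_star.
(* A competitor is contractive, hence determined by its values on the dense union. *)
move=> h [hh hmuE]; apply: funext => a; have [u [v [uv ua va]]] := gP a.
apply: seq_cvg_unique va _; apply/cvg_rnormP => e.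
move=> /((cvg_rnormP _ _).1 ua)[N NP]; exists N => n /NP; apply: le_lt_trans.
have [m [x [uE vE]]] := uv n.
by rewrite vE -hmuE -uE -(star_homB hh); exact: star_hom_contract.
Qed.

End UniversalProperty.

(** By [mu_norm] and contractivity, |mu n x| is the infimum of the norms of the images of x at later
    stages, which is the norm that x must have in the limit. *)
Lemma inductive_limit_criterion : inductive_limit phi mu.
Proof. by split=> // B nu hnu; exact: criterion_extension. Qed.

End Criterion.

End InductiveLimits.

Lemma separable_seq (R : realType) (V : normedModType R[i]) : separable V ->
  exists d : nat -> V, forall (x : V) (e : R), 0 < e -> exists n, rnorm (x - d n) < e.
Proof.
move=> [D /countable_injP[f finj] dD].
have [d dP] : {d : nat -> V | forall x, D x -> d (f x) = x}.
  (* Indices outside the range of [f] receive the default value 0, which does no harm to density. *)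
  pose inv n := [set x | D x /\ f x = n].
  exists (fun n => xget 0 (inv n)) => x Dx; case: xgetP => [y _ [Dy fyx]|].
    by apply: finj => //; exact/mem_set.
  by move=> /(_ x)[].
exists d => x e e0.
have [||y []] := dD (ball x e%:C).
- by exists x; apply: ballxx; rewrite ltcR.
- by apply: ball_open; rewrite ltcR.
by rewrite -ball_normE/= normc_lt => xy Dy; exists (f y); rewrite dP.
Qed.

(** * One step of the construction *)

Section OneStep.
Variables (R : realType) (CC : cstarType R -> Prop).
Hypothesis CCw : forall C : cstarType R, CC C -> weakly_semiprojective C.
Variables (A : cstarType R) (a : nat -> A).
Hypotheses (a_dense : forall (x : A) (e : R), 0 < e -> exists n, rnorm (x - a n) < e)
  (A_like : AC_like CC A).

Lemma AC_like_seq : exists B : nat -> subCstar A,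
  (forall n, AC_algebra CC (sub_alg (B n))) /\
  forall (x : A) (e : R), 0 < e ->
    exists N, forall n, (N <= n)%N -> exists2 y, sub_set (B n) y & rnorm (x - y) < e.
Proof.
(* B n approximates the terms [a i] with i < n up to 2^-n. *)
have /choice[B BP] n := A_like (@geo_gt0 R n) (finite_image a (finite_II n)).
exists B; split=> [n|x e e0]; first exact: (BP n).1.
have e20 : 0 < e / 2%:R by lra.
have [[i xi] [N NP]] := (a_dense x e20, geo_lt e20).
exists (maxn i.+1 N) => n; rewrite geq_max => /andP[ni /NP ne].
have [|y By] := (BP n).2 (a i); first by exists i.
rewrite normc_lt => ay; exists y => //.
by have := rnorm_dist (a i) x y; lra.
Qed.

(** chi is lifted to a subalgebra B n close to G, and this lift to a stage [D k] of an inductive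
    system with limit B n. Each lift costs e/4 in distance; in norm, |psi x| < |psi1 x| + e/4 < |chi
    x| + e/2. Both lifts exist at all large indices, which leaves room to come close to G as
    well. *)
Lemma intertwining_step (C : cstarType R) (chi : C -> A) (F : set C) (G : set A) (e : R) :
  CC C -> star_hom chi -> finite_set F -> finite_set G -> 0 < e ->
  exists (D : cstarType R) (chi' : D -> A) (psi : C -> D),
    [/\ CC D, star_hom chi', star_hom psi,
      forall x, F x -> rnorm (chi' (psi x) - chi x) < e /\ rnorm (psi x) < rnorm (chi x) + e
    & forall x, G x -> exists y, rnorm (chi' y - x) < e].
Proof.
move=> /CCw Cw hchi finF finG e0; have e40 : 0 < e / 4%:R by lra.
have [B [BAC BP]] := AC_like_seq.
have [N1 P1] := lift_to_subalgebras BP Cw hchi finF e40.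
have [|N2 P2] := @finite_eventually _ G
    (fun x n => exists2 y, sub_set (B n) y & rnorm (x - y) < e / 4%:R) finG.
  by move=> x _; exact: BP.
have [psi1 hpsi1 psi1E] := P1 _ (leq_maxl N1 N2).
have {P2} GB := P2 _ (leq_maxr N1 N2); move: psi1 hpsi1 psi1E GB.
move: (maxn N1 N2) => n psi1 hpsi1 psi1E GB.
have [D [phi [L [mu0 [DC hphi hmu0 [f hf bf]]]]]] := BAC n.
pose mu k : D k -> sub_alg (B n) := f \o mu0 k.
have hmu : inductive_limit phi mu := inductive_limit_iso hmu0 hf bf.
have [M1 Q1] := lift_to_stages hphi hmu Cw hpsi1 finF e40.
have [|M2 Q2] := @finite_eventually _ G
    (fun x k => exists y : D k, rnorm (val (mu k y) - x) < e) finG.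
  move=> x /GB[y By xy].
  have [k [z yz]] := inductive_limit_dense (mksub By) hmu e40.
  (* An approximant found at stage k persists at all later stages. *)
  exists k => m km; exists (push phi z m); rewrite (cocone_push _ hmu.1)//.
  have {}yz : rnorm (y - val (mu k z)) < e / 4%:R := yz.
  have := rnorm_dist y (val (mu k z)) x.
  by rewrite (rnormBC (val (mu k z)) y) (rnormBC y x); lra.
have [psi hpsi psiE] := Q1 _ (leq_maxl M1 M2).
have GD := Q2 _ (leq_maxr M1 M2).
exists (D (maxn M1 M2)), (val \o mu (maxn M1 M2)), psi; split=> //.
- exact: star_hom_comp (val_star_hom (B n)) (hmu.1.1 _).
- move=> x Fx; have := psi1E x Fx; have [] := psiE x Fx.
  rewrite -rnorm_val [val _](star_homB (val_star_hom (B n))) /= => h1 h2 h3.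
  split; first by have := rnorm_dist (val (psi1 x)) (val (mu _ (psi x))) (chi x); lra.
  have := rnorm_le_dist (val (psi1 x)) (chi x); rewrite rnorm_val; lra.
Qed.

End OneStep.

(** * The limit of an approximate intertwining *)

Section Intertwining.
Variables (R : realType) (C : nat -> cstarType R) (phi : forall n, C n -> C n.+1).
Hypothesis hphi : forall n, star_hom (@phi n).
Variables (A : cstarType R) (chi : forall n, C n -> A).
Arguments chi : clear implicits.
Hypothesis hchi : forall n, star_hom (chi n).
Variables (d : forall n, nat -> C n) (N : nat -> nat) (a : nat -> A).
Hypotheses
  (d_dense : forall n (x : C n) (e : R), 0 < e -> exists i, rnorm (x - d n i) < e)
  (a_dense : forall (x : A) (e : R), 0 < e -> exists i, rnorm (x - a i) < e)
  (dS : forall n i, d n.+1 i.*2 = phi (d n i))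
  (NS : forall n, ((N n).*2 + 2 ^ n.+1 <= N n.+1)%N)
  (chi_near : forall n i, (i < N n)%N ->
    rnorm (chi n.+1 (phi (d n i)) - chi n (d n i)) <= geo n)
  (phi_norm : forall n i, (i < N n)%N ->
    rnorm (phi (d n i)) <= rnorm (chi n (d n i)) + geo n)
  (a_near : forall n i, (i <= n)%N ->
    exists2 j, (j < N n.+1)%N & rnorm (chi n.+1 (d n.+1 j) - a i) <= geo n).

(** From stage k on, the images of x are among the tracked terms, to which [chi_near] and [phi_norm]
    apply. *)
Let controlled n (x : C n) k :=
  (n <= k)%N /\ forall m, (k <= m)%N -> exists2 i, (i < N m)%N & push phi x m = d m i.

(** In [NS], the doubling follows the index change of [dS] and keeps tracked terms tracked; the
    summand 2^(n+1) makes [N n] outgrow every multiple of 2^n, so that each term is tracked in the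
    end. *)
Let size_ge n : (n * 2 ^ n <= N n)%N.
Proof.
elim: n => // n IH; apply: leq_trans (NS n).
by rewrite mulSn addnC leq_add2r expnS mulnCA mul2n leq_double.
Qed.

Let push_d n i m : (n <= m)%N -> push phi (d n i) m = d m (2 ^ (m - n) * i)%N.
Proof.
move: m; apply: leq_ind => [|m nm IH]; first by rewrite push_id subnn expn0 mul1n.
by rewrite pushS// IH -dS subSn// expnS -mulnA mul2n.
Qed.

Let controlled_size n j : (j < N n)%N -> controlled (d n j) n.
Proof.
move=> jN; split=> // m nm; exists (2 ^ (m - n) * j)%N; last exact: push_d.
move: m nm; apply: leq_ind => [|m nm IH]; first by rewrite subnn expn0 mul1n.
apply: leq_trans (NS m); rewrite subSn// expnS -mulnA mul2n.
by apply: ltn_addr; rewrite ltn_double.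
Qed.

Let controlled_dense n i : exists k, controlled (d n i) k.
Proof.
exists (maxn n i.+1); split=> [|m]; first exact: leq_maxl.
(* For m > i, 2^(m-n) i <= 2^m i < m 2^m <= [N m]. *)
rewrite geq_max => /andP[nm im]; exists (2 ^ (m - n) * i)%N; last exact: push_d.
apply: leq_trans (size_ge m); rewrite mulnC.
apply: (@leq_ltn_trans (i * 2 ^ m)%N); first by rewrite leq_mul2l leq_exp2l// leq_subr orbT.
by rewrite ltn_mul2r expn_gt0.
Qed.

Let u n (x : C n) m := chi m (push phi x m).

Let uB n (x y : C n) m : rnorm (u x m - u y m) <= rnorm (x - y).
Proof.
rewrite -(star_homB (hchi m)) -(star_homB (push_star_hom hphi n m)).
apply: le_trans (star_hom_contract _ (hchi m)) _; exact: rnorm_push.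
Qed.

Let u_dist n (x : C n) k : controlled x k -> forall l m, (k <= l)%N -> (l <= m)%N ->
  rnorm (u x m - u x l) <= geo l + geo l.
Proof.
move=> [nk xk] l m kl lm.
have := @geo_dist _ _ (u x) l _ m lm; have := @geo_gt0 R m.
suff h p : (l <= p)%N -> rnorm (u x p.+1 - u x p) <= geo p.
  by move=> g0 /(_ h); lra.
move=> lp; have kp := leq_trans kl lp; have [i iN xi] := xk p kp.
by rewrite /u pushS ?(leq_trans nk)// xi; exact: chi_near.
Qed.

Let u_cvg n (x : C n) : {l : A | u x @ \oo --> l}.
Proof.
apply: cid; apply: cauchy_seq_cvg => e e0; have e40 : 0 < e / 4%:R by lra.
(* A term of the dense sequence stands in for x; by [uB] the error is uniform in m. *)
have [i xy] := d_dense x e40; have [k yk] := controlled_dense n i.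
have [K KP] := geo_lt e40; exists (maxn k K) => m lm.
have := u_dist yk (leq_maxl k K) lm; have := KP _ (leq_maxr k K).
have := uB x (d n i) m; have := uB x (d n i) (maxn k K); rewrite (rnormBC (u x (maxn k K))).
have := rnorm_dist (u (d n i) m) (u x m) (u x (maxn k K)).
have := rnorm_dist (u (d n i) (maxn k K)) (u (d n i) m) (u x (maxn k K)).
lra.
Qed.

Let mu n (x : C n) : A := sval (u_cvg x).

Let muP n (x : C n) : u x @ \oo --> mu x. Proof. exact: svalP (u_cvg x). Qed.

Let mu_cocone : cocone phi mu.
Proof.
split=> [n|n x].
  have hu m : star_hom (fun x : C n => u x m).
    exact: star_hom_comp (hchi m) (push_star_hom hphi n m).
  split=> [c x y|x y|x]; apply: seq_cvg_unique (@muP _ _) _.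
  - apply: (@cvg_eventually _ _ (fun m => c *: u x m + u y m) _ _ 0%N) => [m _|].
      by rewrite (star_hom_linear (hu m)).
    by apply: cvgD (@muP n y); apply: cvg_scale; exact: muP.
  - apply: (@cvg_eventually _ _ (fun m => amul (u x m) (u y m)) _ _ 0%N) => [m _|].
      by rewrite (star_homM (hu m)).
    by apply: cvg_amul; exact: muP.
  - apply: (@cvg_eventually _ _ (fun m => astar (u x m)) _ _ 0%N) => [m _|].
      by rewrite (star_homV (hu m)).
    by apply: cvg_astar; exact: muP.
apply: seq_cvg_unique (@muP _ _) _.
apply: (@cvg_eventually _ _ (u x) _ _ n.+1) (@muP n x) => m nm.
by rewrite /u push_phi.
Qed.

(** For a controlled y, [phi_norm] bounds the next image of y by |u y m| + 2^-m, and u y m tends to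
    mu y. Replacing x by y costs e/4 in C and e/4 in A. *)
Let mu_norm n (x : C n) (e : R) : 0 < e ->
  exists2 m, (n <= m)%N & rnorm (push phi x m) <= rnorm (mu x) + e.
Proof.
move=> e0; have e40 : 0 < e / 4%:R by lra.
have [i xy] := d_dense x e40; set y := d n i in xy *.
have [k [nk yk]] := controlled_dense n i.
have [K KP] := geo_lt e40; have [M MP] := (cvg_rnormP _ _).1 (@muP _ y) _ e40.
pose m := maxn k (maxn K M).
have [km Km Mm] : [/\ (k <= m)%N, (K <= m)%N & (M <= m)%N].
  by rewrite /m !leq_max !leqnn !orbT.
(* The index is m + 1 because [phi_norm] at stage m bounds the image one stage later. *)
have nm := leq_trans nk km; exists m.+1; first exact: leqW.
have [j jN yj] := yk m km.
have := phi_norm jN; rewrite -yj -pushS// -/(u y m) => h.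
have := KP m Km; have := MP m Mm; rewrite rnormBC.
have := rnorm_le_dist (u y m) (mu y); have := rnorm_le_dist (mu y) (mu x).
rewrite -(star_homB (mu_cocone.1 n)).
have := star_hom_contract (y - x) (mu_cocone.1 n); rewrite (rnormBC y).
have := rnorm_le_dist (push phi x m.+1) (push phi y m.+1).
rewrite -(star_homB (push_star_hom hphi n m.+1)); have := rnorm_push hphi (x - y) m.+1.
lra.
Qed.

(** By [a_near], some tracked y at stage n + 1 has chi y within 2^-n of a term of [a] close to x,
    and being tracked, y moves by at most 2 * 2^-(n+1) = 2^-n on the way to mu y. *)
Let mu_dense (x : A) (e : R) : 0 < e -> exists n (y : C n), rnorm (x - mu y) < e.
Proof.
move=> e0; have e40 : 0 < e / 4%:R by lra.
have [i xi] := a_dense x e40; have [K KP] := geo_lt e40.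
pose n := maxn i K; have ge := KP n (leq_maxr i K).
have [j jN aj] := a_near (leq_maxl i K : (i <= n)%N).
exists n.+1, (d n.+1 j); set y := d n.+1 j in aj *.
have [M MP] := (cvg_rnormP _ _).1 (@muP _ y) _ e40.
have := MP _ (leq_maxl M n.+1).
have := u_dist (controlled_size jN) (leqnn _) (leq_maxr M n.+1); rewrite -/y {2}/u push_id.
have := rnorm_dist (a i) x (mu y); have := rnorm_dist (chi n.+1 y) (a i) (mu y).
have := rnorm_dist (u y (maxn M n.+1)) (chi n.+1 y) (mu y).
rewrite (rnormBC (a i) (chi n.+1 y)) (rnormBC (mu y) (u y _)).
rewrite (rnormBC (chi n.+1 y) (u y _)).
have := geoS R n; lra.
Qed.

Lemma intertwining_inductive_limit :
  exists mu : forall n, C n -> A, inductive_limit phi mu.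
Proof. by exists mu; exact: inductive_limit_criterion mu_cocone mu_norm mu_dense. Qed.

End Intertwining.

(** * Recursive choice of the stages *)

Section Stages.
Variables (R : realType) (CC : cstarType R -> Prop) (A : cstarType R) (a : nat -> A).

(** Everything that the next choice depends on is bundled, so that the sequence of stages is a plain
    recursion; [stage_size] is the number of tracked terms of [stage_seq]. *)
Record stage := Stage {
  stage_alg : cstarType R;
  stage_map : stage_alg -> A;
  stage_seq : nat -> stage_alg;
  stage_size : nat;
  stage_CC : CC stage_alg;
  stage_hom : star_hom stage_map;
  stage_dense : forall (x : stage_alg) (e : R), 0 < e ->
    exists i, rnorm (x - stage_seq i) < e
}.

Record stage_rel n (S T : stage) (f : stage_alg S -> stage_alg T) : Prop := StageRel {
  stage_rel_hom : star_hom f;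
  stage_rel_seq : forall i, stage_seq T i.*2 = f (stage_seq S i);
  stage_rel_size : ((stage_size S).*2 + 2 ^ n.+1 <= stage_size T)%N;
  stage_rel_near : forall i, (i < stage_size S)%N ->
    rnorm (stage_map (f (stage_seq S i)) - stage_map (stage_seq S i)) <= geo n;
  stage_rel_norm : forall i, (i < stage_size S)%N ->
    rnorm (f (stage_seq S i)) <= rnorm (stage_map (stage_seq S i)) + geo n;
  stage_rel_dense : forall i, (i <= n)%N ->
    exists2 j, (j < stage_size T)%N & rnorm (stage_map (stage_seq T j) - a i) <= geo n
}.

Hypothesis hCC : forall C : cstarType R, CC C -> separable C /\ weakly_semiprojective C.
Hypotheses (a_dense : forall (x : A) (e : R), 0 < e -> exists n, rnorm (x - a n) < e)
  (A_like : AC_like CC A).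

Lemma stage_next n S : exists T (f : stage_alg S -> stage_alg T), stage_rel n f.
Proof.
have CCw C : CC C -> weakly_semiprojective C by move=> /hCC[].
have finF : finite_set (@stage_seq S @` `I_(stage_size S)) by exact/finite_image/finite_II.
have finG : finite_set (a @` `I_n.+1) by exact/finite_image/finite_II.
(* The tolerance is 2^-(n+1): the other half of 2^-n is spent below on moving a point of D to a term
   of its dense sequence. *)
have [D [chi [psi [DC hchi hpsi psiP aP]]]] := intertwining_step CCw a_dense A_like
  (stage_CC S) (stage_hom S) finF finG (@geo_gt0 R n.+1).
have [d dP] := separable_seq (hCC DC).1.
(* Even terms carry the images of the preceding sequence, odd terms provide density in D. *)
pose d' i := if odd i then d i./2 else psi (stage_seq S i./2).
have d'_dense (x : D) (e : R) : 0 < e -> exists i, rnorm (x - d' i) < e.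
  by move=> /(dP x)[i xi]; exists i.*2.+1; rewrite /d' /= odd_double uphalf_double.
have [|J JP] := @finite_eventually _ _
    (fun x k => exists2 j, (j < k)%N & rnorm (chi (d' j) - x) <= geo n) finG.
  move=> x /aP[y yx]; have [j yj] := d'_dense y _ (@geo_gt0 R n.+1).
  exists j.+1 => k jk; exists j => //.
  have := star_hom_contract (y - d' j) hchi; rewrite (star_homB hchi).
  have := rnorm_dist (chi y) (chi (d' j)) x; rewrite (rnormBC (chi (d' j)) (chi y)).
  by have := geoS R n; lra.
pose s := maxn J ((stage_size S).*2 + 2 ^ n.+1)%N.
have gle : geo n.+1 <= geo n :> R by exact: geo_le.
exists (Stage s DC hchi d'_dense), psi; split=> //=.
- by move=> i; rewrite /d' odd_double doubleK.
- exact: leq_maxr.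
- move=> i iS; have [|h _] := psiP (stage_seq S i); first by exists i.
  by apply: le_trans gle; exact: ltW.
- move=> i iS; have [|_ h] := psiP (stage_seq S i); first by exists i.
  by apply: ltW (lt_le_trans h _); rewrite lerD2l.
- by move=> i ii; apply: JP; [exact: leq_maxl|exists i].
Qed.

Lemma stage_first : exists S : stage, True.
Proof.
have [B [[C [phi [L [mu [hC _ hmu [f hf _]]]]]] _]] := A_like ltr01 (@finite_set0 A).
have [d dP] := separable_seq (hCC (hC 0%N)).1.
have hchi : star_hom (val \o f \o mu 0%N).
  exact: star_hom_comp (star_hom_comp (val_star_hom B) hf) (hmu.1.1 0%N).
(* With no tracked term, the estimates on the first connecting morphism are vacuous. *)
by exists (Stage 0 (hC 0%N) hchi dP).
Qed.

End Stages.

Theorem theorem3p9 (R : realType) (CC : cstarType R -> Prop)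
  (hCC : forall C : cstarType R, CC C -> separable C /\ weakly_semiprojective C)
  (A : cstarType R) :
  separable A -> AC_like CC A -> AC_algebra CC A.
Proof.
move=> /separable_seq[a a_dense] A_like.
have [S0 _] := stage_first hCC A_like.
pose next n (S : stage CC A) := cid (stage_next hCC a_dense A_like n S).
pose S := fix S n := if n is m.+1 then sval (next m (S m)) else S0.
pose f n : stage_alg (S n) -> stage_alg (S n.+1) := sval (cid (svalP (next n (S n)))).
have fP n : stage_rel a n (f n) := svalP (cid (svalP (next n (S n)))).
have hf n := stage_rel_hom (fP n).
have [mu hmu] := intertwining_inductive_limit hf (fun n => stage_hom (S n))
  (fun n => @stage_dense _ _ _ (S n)) a_dense (fun n => stage_rel_seq (fP n))
  (fun n => stage_rel_size (fP n)) (fun n => stage_rel_near (fP n))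
  (fun n => stage_rel_norm (fP n)) (fun n => stage_rel_dense (fP n)).
(* A itself is the limit object, so the isomorphism is the identity. *)
exists (fun n => stage_alg (S n)), f, A, mu; split=> //.
- by move=> n; exact: stage_CC.
- by exists id; [exact: star_hom_id|exists id].
Qed.
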